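(* (i) For any $n\ge0$, $f_n\in\mathrm{Osc}_1(S_n)$, $N\ge1$ and $0\le\epsilon\le1/2$, $$\mathbb P\big(|[\eta_n^N-\eta_n](f_n)|\ge\epsilon\big)\le6\exp\Big(-\frac{N\epsilon^2}{8\sigma_{1,n}}\Big),\qquad\sigma_{1,n}:=4\sum_{p=0}^nq_{p,n}^3\beta(\mathcal P_{p,n}).$$ (ii) Suppose in addition that condition $(\mathcal M)_m$ holds for some $m\ge1$ and that $\delta:=\inf_p\delta_p>0$, $\overline r:=\sup_pr_{p,p+m}<\infty$ and $\underline r:=\sup_pr_{p+1,p+m}<\infty$. Then for every $n\ge0$, $f_n\in\mathrm{Osc}_1(S_n)$, $N\ge1$ and $\rho\in(0,1)$, with probability at least $1-\rho$, $$|[\eta_n^N-\eta_n](f_n)|\le\frac{4\overline r}{\delta^2}\sqrt{\frac{2m\underline r\,\overline r}{N\delta}\log\Big(\frac6\rho\Big)}.$$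
   Context: Let $(S_n)_{n\ge0}$ be measurable spaces, $\eta_0\in\mathcal P(S_0)$, $\mathcal M_n$ ($n\ge1$) Markov kernels from $S_{n-1}$ to $S_n$, and $\mathcal G_n:S_n\to(0,1)$ ($n\ge0$) measurable with $q_n:=\sup_{x,y}\mathcal G_n(x)/\mathcal G_n(y)<\infty$. Limiting flow: $\eta_{n+1}:=\Psi_n(\eta_n)\mathcal M_{n+1}$ with $\Psi_n(\mu)(dx):=\mathcal G_n(x)\mu(dx)/\mu(\mathcal G_n)$. Let $\mathcal Q_{p+1}(x,dy):=\mathcal G_p(x)\mathcal M_{p+1}(x,dy)$, $\mathcal Q_{p,n}:=\mathcal Q_{p+1}\cdots\mathcal Q_n$ ($\mathcal Q_{n,n}=\mathrm{Id}$), $\mathcal P_{p,n}(f):=\mathcal Q_{p,n}(f)/\mathcal Q_{p,n}(1)$, $q_{p,n}:=\sup_{x,y\in S_p}\mathcal Q_{p,n}(1)(x)/\mathcal Q_{p,n}(1)(y)$, $\beta(\mathcal P_{p,n}):=\sup_{f\in\mathrm{Osc}_1(S_n)}\mathrm{osc}(\mathcal P_{p,n}f)$, where $\mathrm{osc}(f)=\sup_{x,y}|f(x)-f(y)|$ and $\mathrm{Osc}_1(E)$ is the set of measurable functions with oscillation at most $1$. Particle system: $\mathcal S_{n,\mu}(x,dy):=\mathcal G_n(x)\delta_x(dy)+(1-\mathcal G_n(x))\mathcal G_n(y)\mu(dy)/\mu(\mathcal G_n)$, $\mathcal K_{n+1,\mu}:=\mathcal S_{n,\mu}\mathcal M_{n+1}$;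 $\mathcal X_0^{(N,i)}$ i.i.d. $\eta_0$, and given $\mathcal X_n^{(N)}$ the $\mathcal X_{n+1}^{(N,i)}$ are conditionally independent with laws $\mathcal K_{n+1,\eta_n^N}(\mathcal X_n^{(N,i)},\cdot)$, $\eta_n^N:=\frac1N\sum_i\delta_{\mathcal X_n^{(N,i)}}$. Condition $(\mathcal M)_m$: there is a sequence $(\delta_p)_{p\ge0}\subset(0,1)$ such that for all $p\ge0$ and $x,y\in S_p$, $\mathcal M_{p,p+m}(x,\cdot)\ge\delta_p\mathcal M_{p,p+m}(y,\cdot)$, where $\mathcal M_{p,p+m}:=\mathcal M_{p+1}\cdots\mathcal M_{p+m}$. For $k\le l$, $r_{k,l}:=\sup\prod_{k\le p<l}\mathcal G_p(x_p)/\mathcal G_p(y_p)$, the supremum being over all pairs of paths $(x_k,\dots,x_{l-1})$, $(y_k,\dots,y_{l-1})$ admissible for the transitions $\mathcal M_p$. *)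

(* Defs.v *)
From HB Require Import structures.
From mathcomp Require Import all_boot all_order all_algebra.
From mathcomp Require Import all_classical all_reals all_analysis.
Unset Strict Implicit.
Unset Printing Implicit Defensive.
Import Order.TTheory GRing.Theory Num.Theory.
Import numFieldNormedType.Exports.
Local Open Scope classical_set_scope.
Local Open Scope ring_scope.

Definition Osc1 {R : realType} {d} {T : measurableType d} (f : T -> R) : Prop :=
  measurable_fun setT f /\ forall x y, `|f x - f y| <= 1.

Section FeynmanKac.
Variables (R : realType) (d : nat -> measure_display)
  (S : forall n, measurableType (d n)).
(* eta0 : initial law on S 0;
   M n : the Markov kernel  M_{n+1}  from S n to S (n+1);
   G n : the potential  G_n  on S n. *)
Variables (eta0 : probability (S 0) R) (M : forall n, R.-pker S n ~> S n.+1)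
  (G : forall n, S n -> R).

Definition Mint n (x : S n) (f : S n.+1 -> R) : R := Rintegral (M n x) setT f.
Arguments Mint {n}.

(* Limiting flow, acting on test functions:
   eta_0(f) = int f d eta0,
   eta_{n+1}(f) = Psi_n(eta_n) M_{n+1} (f) = eta_n(G_n M_{n+1} f) / eta_n(G_n). *)
Fixpoint etaFK (n : nat) : (S n -> R) -> R :=
  match n return (S n -> R) -> R with
  | 0 => fun f => Rintegral eta0 setT f
  | n'.+1 => fun f => etaFK n' (fun x => G n' x * Mint x f) / etaFK n' (G n')
  end.

Fixpoint Qf (p k : nat) : (S (k + p) -> R) -> S p -> R :=
  match k return (S (k + p) -> R) -> S p -> R with
  | 0 => fun f => f
  | k'.+1 => fun f => Qf p k' (fun x : S (k' + p) => G (k' + p) x * Mint x f)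
  end.

(* transport of a function along an equality of indices (junk 0 otherwise) *)
Definition tcast (m n : nat) (f : S m -> R) : S n -> R :=
  match m =P n with
  | ReflectT e => eq_rect m (fun j => S j -> R) f n e
  | ReflectF _ => fun _ => 0
  end.

Definition Qpn (p n : nat) (f : S n -> R) : S p -> R :=
  Qf p (n - p) (tcast n (n - p + p) f).

Definition Ppn (p n : nat) (f : S n -> R) (x : S p) : R :=
  Qpn p n f x / Qpn p n (fun _ => 1) x.

Definition qpn (p n : nat) : R :=
  sup [set r | exists x y : S p,
         r = Qpn p n (fun _ => 1) x / Qpn p n (fun _ => 1) y].

Definition beta (p n : nat) : R :=
  sup [set r | exists (f : S n -> R) (x y : S p),
         Osc1 f /\ r = `|Ppn p n f x - Ppn p n f y|].

Definition sigma1 (n : nat) : R :=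
  4 * \sum_(0 <= p < n.+1) (qpn p n ^+ 3 * beta p n).

Fixpoint Mf (p k : nat) : (S (k + p) -> R) -> S p -> R :=
  match k return (S (k + p) -> R) -> S p -> R with
  | 0 => fun f => f
  | k'.+1 => fun f => Mf p k' (fun x : S (k' + p) => Mint x f)
  end.

Definition condM (m : nat) (delta : nat -> R) : Prop :=
  (forall p, 0 < delta p < 1) /\
  forall p (x y : S p) (B : set (S (m + p))), measurable B ->
    Mf p m (\1_B) x >= delta p * Mf p m (\1_B) y.

(* Wexc r len p a x y : probability, for two independent M-chains started at
   x and y at time p, that  a * prod_{j=p}^{p+len-1} G_j(X_j)/G_j(Y_j) > r. *)
Fixpoint Wexc (r : R) (len : nat) : forall p, R -> S p -> S p -> R :=
  match len with
  | 0 => fun p a _ _ => if r < a then 1 else 0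
  | len'.+1 => fun p a x y =>
      Mint x (fun x' => Mint y (fun y' =>
        Wexc r len' p.+1 (a * (G p x / G p y)) x' y'))
  end.

(* r_{k,l} = sup over pairs of admissible paths (x_k..x_{l-1}), (y_k..y_{l-1})
   of prod_{k<=p<l} G_p(x_p)/G_p(y_p); "admissible" is read as
   "almost surely for the transitions M_p" (essential supremum). *)
Definition rkl (k l : nat) : R :=
  inf [set r | 0 < r /\ forall x y : S k, Wexc r (l - k) k 1 x y = 0].

(* K_{n+1, eta_n^N}(x, B) with eta_n^N the empirical measure of xs. *)
Definition Kemp N n (xs : 'I_N -> S n) (x : S n) (B : set (S n.+1)) : R :=
  G n x * fine (M n x B) + (1 - G n x) *
    ((\sum_(j < N) G n (xs j) * fine (M n (xs j) B)) / \sum_(j < N) G n (xs j)).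

Definition empir N n (xs : 'I_N -> S n) (f : S n -> R) : R :=
  (N%:R)^-1 * \sum_(i < N) f (xs i).

(* X n i : the i-th particle at time n, on a probability space (Omega, P).
   The X_0^i are i.i.d. with law eta0, and given X_n the X_{n+1}^i are
   conditionally independent with laws K_{n+1,eta_n^N}(X_n^i, .); the latter is
   expressed through the joint law of (X_n, X_{n+1}) on measurable rectangles. *)
Definition particle_system (N : nat) dO (Omega : measurableType dO)
  (P : probability Omega R) (X : forall n, 'I_N -> Omega -> S n) : Prop :=
  [/\ forall n i, measurable_fun setT (X n i),
      forall A : 'I_N -> set (S 0), (forall i, measurable (A i)) ->
        P (\bigcap_(i in setT) [set w | A i (X 0 i w)]) =
        (\prod_(i < N) fine (eta0 (A i)))%:E &
      forall n (A : 'I_N -> set (S n)) (B : 'I_N -> set (S n.+1)),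
        (forall i, measurable (A i)) -> (forall i, measurable (B i)) ->
        P (\bigcap_(i in setT) [set w | A i (X n i w) /\ B i (X n.+1 i w)]) =
        (\int[P]_w (\prod_(i < N)
            (\1_(A i) (X n i w) * Kemp N n (fun j => X n j w) (X n i w) (B i)))%:E)%E].

End FeynmanKac.

Arguments Mint {R d S} M {n}.
Arguments etaFK {R d S} eta0 M G {n}.
Arguments sigma1 {R d S} M G n.
Arguments condM {R d S} M m delta.
Arguments rkl {R d S} M G k l.
Arguments empir {R d S N n}.
Arguments Kemp {R d S} M G {N n}.
Arguments particle_system {R d S} eta0 M G {N dO Omega} P X.

(* Main.v *)
(** Write [Q_{p,n}] for the unnormalised semigroup.  The particle approximation
    is followed backwards in time through the ratios
    [F_p = sum_i Q_{p,n} f (X_p^i) / sum_i Q_{p,n} 1 (X_p^i)]: [F_n] is the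
    empirical mean of [f], and replacing the particles of generation [p+1] by
    their conditional laws given generation [p] turns [F_{p+1}] into [F_p].
    Resampling the particles of one generation one at a time changes the ratio
    by [O(q_{p,n} beta_{p,n} / N)] with a bias [O(q_{p,n}^2 beta_{p,n} / N^2)],
    which controls [E exp(s F_{p+1})] by [E exp(s F_p)].  Only the joint laws of
    consecutive generations are used.  Chernoff's bound gives, for
    [sum_p q_{p,n}^2 beta_{p,n} <= T] and [0 <= eps <= 1], the tail
    [6 exp(- N eps^2 / (16 T))], which is better than (i).

    For (ii), comparing two independent [M]-chains on a window of times gives
    [q_{p,n} <= r_{p,p+m} / delta_p] and the contraction
    [beta_{p,n} <= (1 - delta^2 / r)^k] when [n - p >= k m].  When [n - p < m],
    [q_{p,n}] need not be at most [rbar / delta]: chaining the window [[p,p+m)]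
    with a window starting at [n] gives instead
    [q_{p,n}^2 <= rbar^3 rlow / delta^2], and this loss is absorbed by the slack
    in the constants of the tail bound. *)

Require Import Defs.
From HB Require Import structures.
From mathcomp Require Import all_boot all_order all_algebra.
From mathcomp Require Import all_classical all_reals all_analysis.
From mathcomp Require Import measurable_realfun ring lra.
Import Order.TTheory GRing.Theory Num.Theory.
Import numFieldNormedType.Exports.
Local Open Scope classical_set_scope.
Local Open Scope ring_scope.

(** * Bounded measurable functions and normalised positive functionals *)

Definition bdm {R : realType} {d} {T : measurableType d} (f : T -> R) : Prop :=
  measurable_fun setT f /\ exists C, forall x, `|f x| <= C.

(** A probability seen only through its action on bounded measurable functions, without countable
    additivity. Kernels, [Ppn], empirical means and [etaFK], which is given only as a functional,
    all share this interface. *)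
Definition is_mean {R : realType} {d} {T : measurableType d}
    (L : (T -> R) -> R) : Prop :=
  [/\ L (fun=> 1) = 1,
      forall c f g, bdm f -> bdm g ->
        L (fun x => c * f x + g x) = c * L f + L g &
      forall f, bdm f -> (forall x, 0 <= f x) -> 0 <= L f].

Section BoundedMeasurable.
Context {R : realType} {d : measure_display} {T : measurableType d}.
Implicit Types f g : T -> R.

Lemma bdm_cst (c : R) : bdm (fun _ : T => c).
Proof. by split; [exact: measurable_cst | exists `|c|]. Qed.

Lemma bdmD f g : bdm f -> bdm g -> bdm (fun x => f x + g x).
Proof.
move=> [mf [C hC]] [mg [D hD]]; split; first exact: measurable_funD.
by exists (C + D) => x; rewrite (le_trans (ler_normD _ _))// lerD.
Qed.

Lemma bdmM f g : bdm f -> bdm g -> bdm (fun x => f x * g x).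
Proof.
move=> [mf [C hC]] [mg [D hD]]; split; first exact: measurable_funM.
by exists (C * D) => x; rewrite normrM ler_pM.
Qed.

Lemma bdmZ (c : R) f : bdm f -> bdm (fun x => c * f x).
Proof. exact/bdmM/bdm_cst. Qed.

Lemma bdmB f g : bdm f -> bdm g -> bdm (fun x => f x - g x).
Proof.
move=> bf bg; rewrite (_ : (fun _ => _) = fun x => f x + (-1) * g x).
  exact/bdmD/bdmZ.
by apply/funext => x; rewrite mulN1r.
Qed.

Lemma bdm_sum (I : Type) (s : seq I) (F : I -> T -> R) :
  (forall i, bdm (F i)) -> bdm (fun x => \sum_(i <- s) F i x).
Proof.
move=> bF; elim: s => [|i s ih].
  by under eq_fun do rewrite big_nil; exact: bdm_cst.
by under eq_fun do rewrite big_cons; exact: bdmD.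
Qed.

Lemma bdm_prod (I : Type) (s : seq I) (F : I -> T -> R) :
  (forall i, bdm (F i)) -> bdm (fun x => \prod_(i <- s) F i x).
Proof.
move=> bF; elim: s => [|i s ih].
  by under eq_fun do rewrite big_nil; exact: bdm_cst.
by under eq_fun do rewrite big_cons; exact: bdmM.
Qed.

Lemma bdm_indic (A : set T) : measurable A -> bdm (\1_A : T -> R).
Proof.
move=> mA; split; first exact: measurable_indic.
by exists 1 => x; rewrite indicE; case: (_ \in _); rewrite ?normr1 ?normr0.
Qed.

Lemma measurable_fun_inv_pos f :
  measurable_fun setT f -> (forall x, 0 < f x) ->
  measurable_fun setT (fun x => (f x)^-1).
Proof.
(* On positive values the inverse is [expR (- ln _)], a composite of measurable maps. *)
move=> mf f0; rewrite (_ : (fun _ => _) = fun x => expR (- ln (f x))).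
  by do 2 apply: measurableT_comp => //; exact: measurableT_comp.
by apply/funext => x; rewrite expRN lnK// posrE.
Qed.

Lemma bdmV (lo : R) f : bdm f -> 0 < lo -> (forall x, lo <= f x) ->
  bdm (fun x => (f x)^-1).
Proof.
move=> [mf _] lo0 lof; have f0 x : 0 < f x by exact: lt_le_trans (lof x).
split; first exact: measurable_fun_inv_pos.
by exists lo^-1 => x; rewrite gtr0_norm ?invr_gt0// lef_pV2 ?posrE.
Qed.

Lemma bdm_expR f : bdm f -> bdm (fun x => expR (f x)).
Proof.
move=> [mf [C hC]]; split; first exact: measurableT_comp.
exists (expR C) => x; rewrite ger0_norm ?expR_ge0// ler_expR.
by rewrite (le_trans (ler_norm _)).
Qed.

Lemma bdm_comp {d'} {T' : measurableType d'} (h : T' -> T) f :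
  measurable_fun setT h -> bdm f -> bdm (fun x => f (h x)).
Proof.
move=> mh [mf [C hC]]; split; last by exists C => x.
exact: measurableT_comp.
Qed.

Lemma bdm_integrable (mu : {measure set T -> \bar R}) f :
  mu setT = 1%E -> bdm f -> mu.-integrable setT (EFin \o f).
Proof.
move=> mu1 [mf [C hC]]; apply: measurable_bounded_integrable => //.
  by rewrite mu1 ltry.
exists C; split; first by rewrite num_real.
by move=> r Cr x _ /=; rewrite (le_trans (hC x))// ltW.
Qed.

Lemma Rintegral_mean (mu : {measure set T -> \bar R}) :
  mu setT = 1%E -> is_mean (fun f => Rintegral mu setT f).
Proof.
move=> mu1; split.
- by rewrite Rintegral_cst// mu1/= mulr1.
- move=> c f g bf bg; rewrite RintegralD//; last 2 first.
    by apply: bdm_integrable => //; exact: bdmZ.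
  + exact: bdm_integrable.
  by rewrite RintegralZl//; exact: bdm_integrable.
- by move=> f _ f0; exact: Rintegral_ge0.
Qed.

Lemma Rintegral_indic (mu : {measure set T -> \bar R}) (A : set T) :
  measurable A -> Rintegral mu setT (\1_A) = fine (mu A).
Proof. by move=> mA; rewrite /Rintegral integral_indic// setIT. Qed.

End BoundedMeasurable.

Section Mean.
Context {R : realType} {d : measure_display} {T : measurableType d}.
Variables (L : (T -> R) -> R) (mL : is_mean L).
Implicit Types f g : T -> R.

Lemma mean_lin c f g : bdm f -> bdm g ->
  L (fun x => c * f x + g x) = c * L f + L g.
Proof. by case: mL => _ + _; apply. Qed.

Lemma mean_ge0 f : bdm f -> (forall x, 0 <= f x) -> 0 <= L f.
Proof. by case: mL => _ _; apply. Qed.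

Lemma mean0 : L (fun=> 0) = 0.
Proof.
have := @mean_lin (-1) _ _ (bdm_cst 1) (bdm_cst 1).
under [X in L X]eq_fun do rewrite mulr1 addNr.
by move=> ->; rewrite mulN1r addNr.
Qed.

Lemma meanZ c f : bdm f -> L (fun x => c * f x) = c * L f.
Proof.
move=> bf; have := @mean_lin c _ _ bf (bdm_cst 0).
by under [X in L X]eq_fun do rewrite addr0; rewrite mean0 addr0.
Qed.

Lemma mean_cst c : L (fun=> c) = c.
Proof.
have := @meanZ c _ (bdm_cst 1).
under [X in L X]eq_fun do rewrite mulr1.
by move=> ->; case: mL => -> _ _; rewrite mulr1.
Qed.

Lemma meanD f g : bdm f -> bdm g -> L (fun x => f x + g x) = L f + L g.
Proof.
move=> bf bg; have := @mean_lin 1 _ _ bf bg.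
by under [X in L X]eq_fun do rewrite mul1r; rewrite mul1r.
Qed.

Lemma meanB f g : bdm f -> bdm g -> L (fun x => f x - g x) = L f - L g.
Proof.
move=> bf bg; have := @mean_lin (-1) _ _ bg bf.
rewrite mulN1r addrC => <-; congr (L _).
by apply/funext => x; rewrite mulN1r addrC.
Qed.

Lemma mean_sum (I : Type) (s : seq I) (F : I -> T -> R) :
  (forall i, bdm (F i)) ->
  L (fun x => \sum_(i <- s) F i x) = \sum_(i <- s) L (F i).
Proof.
move=> bF; elim: s => [|i s ih].
  by rewrite big_nil -[RHS]mean0; congr L; apply/funext => x; rewrite big_nil.
rewrite big_cons -ih -meanD//; last exact: bdm_sum.
by congr L; apply/funext => x; rewrite big_cons.
Qed.

Lemma mean_le f g : bdm f -> bdm g -> (forall x, f x <= g x) -> L f <= L g.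
Proof.
move=> bf bg fg; rewrite -subr_ge0 -meanB// mean_ge0//; first exact: bdmB.
by move=> x; rewrite subr_ge0.
Qed.

Lemma mean_ge c f : bdm f -> (forall x, c <= f x) -> c <= L f.
Proof. by move=> bf cf; rewrite -[c]mean_cst mean_le//; exact: bdm_cst. Qed.

Lemma mean_le_cst c f : bdm f -> (forall x, f x <= c) -> L f <= c.
Proof. by move=> bf cf; rewrite -[leRHS]mean_cst mean_le//; exact: bdm_cst. Qed.

Lemma mean_norm c f : bdm f -> (forall x, `|f x| <= c) -> `|L f| <= c.
Proof.
move=> bf cf; rewrite ler_norml; apply/andP; split.
  by apply: mean_ge => // x; have := cf x; rewrite ler_norml => /andP[].
by apply: mean_le_cst => // x; have := cf x; rewrite ler_norml => /andP[].
Qed.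

End Mean.

(** Integrating in [y] at fixed [x] and then in [x] involves only functions of one variable, so no
    product measure appears. *)
Lemma ler_prod_mean {R : realType} {d d'} {T : measurableType d}
    {T' : measurableType d'} (L : (T -> R) -> R) (L' : (T' -> R) -> R)
    (f1 f3 : T -> R) (f2 f4 : T' -> R) (r : R) :
  is_mean L -> is_mean L' -> bdm f1 -> bdm f2 -> bdm f3 -> bdm f4 ->
  (forall x y, f1 x * f2 y <= r * (f3 x * f4 y)) ->
  L f1 * L' f2 <= r * (L f3 * L' f4).
Proof.
move=> mL mL' b1 b2 b3 b4 h.
have -> : L f1 * L' f2 = L (fun x => L' f2 * f1 x) by rewrite meanZ// mulrC.
have -> : r * (L f3 * L' f4) = L (fun x => r * L' f4 * f3 x).
  by rewrite meanZ//; ring.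
apply: mean_le => //; [exact: bdmZ | exact: bdmZ |] => x.
have -> : L' f2 * f1 x = L' (fun y => f1 x * f2 y) by rewrite meanZ// mulrC.
have -> : r * L' f4 * f3 x = L' (fun y => r * f3 x * f4 y).
  by rewrite meanZ//; ring.
by apply: mean_le => //; [exact: bdmZ | exact: bdmZ |] => y; rewrite -mulrA.
Qed.

(** * Exponential moments under finite product laws *)

Lemma expR_le_quadratic {R : realType} (x : R) :
  x <= 1 / 3 -> expR x <= 1 + x + x ^+ 2.
Proof.
move=> x3.
(* Squaring this bounds [expR (- x)] below by [(1 - x / 2) ^+ 2]; what remains is a polynomial
   inequality whose sign is that of [1 - 3 * x + x ^+ 2]. *)
have h1 : 1 - x / 2 <= expR (- x / 2) by rewrite mulNr expR_ge1Dx.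
have h2 : (1 - x / 2) ^+ 2 <= expR (- x).
  have -> : - x = - x / 2 + - x / 2 by field.
  by rewrite expRD expr2 ler_pM//; lra.
have h3 : expR x * (1 - x / 2) ^+ 2 <= 1.
  by rewrite (le_trans (ler_wpM2l (expR_ge0 x) h2))// expRxMexpNx_1.
have h4 : 0 < (1 - x / 2) ^+ 2 by rewrite exprn_gt0//; lra.
rewrite -(ler_pM2r h4); apply: (le_trans h3).
rewrite -subr_ge0; suff -> : (1 + x + x ^+ 2) * (1 - x / 2) ^+ 2 - 1 =
  x ^+ 2 / 4 * ((1 - 3 * x) + x ^+ 2).
  by rewrite mulr_ge0// ?divr_ge0 ?sqr_ge0// addr_ge0 ?sqr_ge0//; lra.
by field.
Qed.

(* Resampling one of [Nr] particles of weights [g] moves the weighted average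
   [A / D] by at most [2 q b / Nr], and by [2 q^2 b / Nr^2] on average. *)
Lemma expR_ratio_resample {R : realType} {C : finType} (w a g : C -> R)
    (A D s q b Nr : R) :
  (forall c, 0 <= w c) -> \sum_c w c = 1 -> (forall c, 0 <= g c) ->
  0 < Nr -> 0 <= q -> 0 <= b -> 0 < D ->
  (forall c, 0 < D + g c - \sum_c w c * g c) ->
  (forall c, Nr * g c <= q * D) ->
  (forall c c', Nr * g c <= q * (D + g c' - \sum_c w c * g c)) ->
  (forall c, `|a c * D - A * g c| <= b * (g c * D)) ->
  `|s| * (2 * q * b / Nr) <= 1 / 3 ->
  \sum_c w c * expR (s * ((A + a c - \sum_c w c * a c) /
                          (D + g c - \sum_c w c * g c))) <=
  expR (s * (A / D) +
    (`|s| * (2 * q ^+ 2 * b / Nr ^+ 2) + s ^+ 2 * (2 * q * b / Nr) ^+ 2)).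
Proof.
set ga := \sum_c w c * g c; set aa := \sum_c w c * a c.
move=> w0 w1 g0 N0 q0 b0 D0 D'0 hD hD' hu hs.
(* [u] is [a] recentred by the current ratio [r], so that [|u c| <= b * g c]; only this recentred
   part moves the ratio. *)
pose r := A / D; pose u c := a c - r * g c; pose ua := \sum_c w c * u c.
have Nn0 : Nr != 0 by rewrite gt_eqF.
have Dn0 : D != 0 by rewrite gt_eqF.
have sumle (h : C -> R) k : (forall c, h c <= k) -> \sum_c w c * h c <= k.
  move=> hk; rewrite -[leRHS]mul1r -w1 mulr_suml ler_sum// => c _.
  by rewrite ler_wpM2l.
have uaE : ua = aa - r * ga.
  rewrite /ua /aa /ga mulr_sumr -sumrB; apply: eq_bigr => c _.
  by rewrite /u; ring.
have uc c : `|u c| <= b * g c.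
  have -> : u c = (a c * D - A * g c) / D by rewrite /u /r; field.
  by rewrite normrM normfV (gtr0_norm D0) ler_pdivrMr// -mulrA.
have ga0 : 0 <= ga by apply: sumr_ge0 => c _; rewrite mulr_ge0.
have uale : `|ua| <= b * ga.
  rewrite /ga mulr_sumr (le_trans (ler_norm_sum _ _ _))// ler_sum// => c _.
  by rewrite normrM (ger0_norm (w0 c)) mulrCA ler_wpM2l.
have gN c : g c <= q * D / Nr by rewrite ler_pdivlMr// mulrC.
have gN' c c' : g c <= q * (D + g c' - ga) / Nr by rewrite ler_pdivlMr// mulrC.
have gaN : ga <= q * D / Nr by exact: sumle.
have gaN' c' : ga <= q * (D + g c' - ga) / Nr.
  by apply: sumle => c; exact: gN'.
have du c : `|u c - ua| <= 2 * q * b / Nr * (D + g c - ga).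
  rewrite (le_trans (ler_normB _ _))// (le_trans (lerD (uc c) uale))//.
  rewrite -mulrDr.
  have -> : 2 * q * b / Nr * (D + g c - ga) =
     b * (q * (D + g c - ga) / Nr + q * (D + g c - ga) / Nr) by field.
  by rewrite ler_wpM2l// lerD.
have dg c : `|g c - ga| <= q * D / Nr.
  have := g0 c; have := gN c; have := gaN; rewrite ler_norml => *.
  by apply/andP; split; lra.
pose del c := (u c - ua) / (D + g c - ga).
have delE c : (A + a c - aa) / (D + g c - ga) = r + del c.
  have := D'0 c; rewrite /del uaE /u /r => /lt0r_neq0 D'n0.
  by field; rewrite D'n0 Dn0.
have del_le c : `|del c| <= 2 * q * b / Nr.
  by rewrite normrM normfV (gtr0_norm (D'0 c)) ler_pdivrMr.
(* With the denominator frozen at [D] the increment [del] would have mean zero; [rest] corrects for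
   the moving denominator and is a product of two small factors, hence a bias of order [Nr ^- 2]. *)
pose rest c := (u c - ua) * (g c - ga) / (D * (D + g c - ga)).
have delR c : del c = (u c - ua) / D - rest c.
  have := D'0 c; rewrite /rest /del => /lt0r_neq0 D'n0.
  by field; rewrite D'n0 Dn0.
have rest_le c : `|rest c| <= 2 * q ^+ 2 * b / Nr ^+ 2.
  rewrite normrM normfV [`|D * _|]gtr0_norm ?mulr_gt0// ler_pdivrMr ?mulr_gt0//.
  rewrite normrM.
  have -> : 2 * q ^+ 2 * b / Nr ^+ 2 * (D * (D + g c - ga)) =
    2 * q * b / Nr * (D + g c - ga) * (q * D / Nr) by field.
  exact: ler_pM.
have sdel : \sum_c w c * del c = - \sum_c w c * rest c.
  have -> : \sum_c w c * del c =
      (\sum_c w c * u c - ua * \sum_c w c) / D - \sum_c w c * rest c.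
    rewrite mulr_sumr -sumrB mulr_suml -sumrB; apply: eq_bigr => c _.
    by rewrite delR; field.
  by rewrite w1 mulr1 subrr mul0r add0r.
under eq_bigr do rewrite delE mulrDr expRD mulrCA.
rewrite -mulr_sumr expRD ler_wpM2l ?expR_ge0//.
apply: le_trans (expR_ge1Dx _).
set B := 2 * q ^+ 2 * b / Nr ^+ 2; set e := 2 * q * b / Nr.
have e0 : 0 <= e by rewrite divr_ge0 ?mulr_ge0// ltW.
have step c : w c * expR (s * del c) <=
    w c * 1 + s * (w c * del c) + w c * (s ^+ 2 * e ^+ 2).
  have -> : w c * 1 + s * (w c * del c) + w c * (s ^+ 2 * e ^+ 2) =
     w c * (1 + s * del c + s ^+ 2 * e ^+ 2) by ring.
  apply: ler_wpM2l => //.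
  have sd : `|s * del c| <= `|s| * e by rewrite normrM ler_wpM2l.
  apply: le_trans (expR_le_quadratic _ _) _.
    exact: le_trans (ler_norm _) (le_trans sd hs).
  rewrite lerD2l exprMn ler_wpM2l ?sqr_ge0//.
  by rewrite -(real_normK (num_real (del c))) lerXn2r ?nnegrE.
apply: (@le_trans _ _ (\sum_c (w c * 1 + s * (w c * del c) +
    w c * (s ^+ 2 * e ^+ 2)))); first exact: ler_sum.
rewrite !big_split/= -!mulr_suml -mulr_sumr w1 !mul1r sdel addrA lerD2r lerD2l.
rewrite (le_trans (ler_norm _))// normrM normrN ler_wpM2l//.
rewrite (le_trans (ler_norm_sum _ _ _))//; apply: le_trans (sumle (fun=> B) B _) => //.
  by apply: ler_sum => c _; rewrite normrM (ger0_norm (w0 c)) ler_wpM2l.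
Qed.

(** Coordinate [k] may be replaced by an independent copy: exchanging the old value with the fresh
    one is an involution that preserves the weights. *)
Lemma sum_prod_resample {R : realType} {C : finType} {N : nat}
    (w : 'I_N -> C -> R) (H : {ffun 'I_N -> C} -> R) (k : 'I_N) :
  \sum_c w k c = 1 ->
  \sum_(b : {ffun 'I_N -> C}) (\prod_i w i (b i)) * H b =
  \sum_(b : {ffun 'I_N -> C}) (\prod_i w i (b i)) *
    \sum_c w k c * H [ffun i => if i == k then c else b i].
Proof.
move=> w1.
pose upd (b : {ffun 'I_N -> C}) c := [ffun i => if i == k then c else b i].
under [RHS]eq_bigr do rewrite mulr_sumr.
rewrite pair_bigA/=.
pose swap (x : {ffun 'I_N -> C} * C) := (upd x.1 x.2, x.1 k).
have swapK : involutive swap.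
  move=> [b c]; rewrite /swap /=; congr (_, _); last by rewrite ffunE eqxx.
  by apply/ffunP => i; rewrite !ffunE; case: eqP => [->|].
rewrite (reindex_inj (inv_inj swapK))/=.
transitivity (\sum_(x : {ffun 'I_N -> C} * C)
    (\prod_i w i (x.1 i)) * (w k x.2 * H x.1)); last first.
  apply: eq_bigr => -[b c] _ /=.
  have -> : [ffun i => if i == k then b k else (upd b c) i] = b.
    by apply/ffunP => i; rewrite !ffunE; case: eqP => [->|].
  rewrite mulrA [RHS]mulrA; congr (_ * _).
  rewrite (bigD1 k)//= [in RHS](bigD1 k)//= ffunE eqxx.
  rewrite mulrAC [RHS]mulrAC [w k c * _]mulrC; congr (_ * _); apply: eq_bigr => i ik.
  by rewrite ffunE (negbTE ik).
rewrite -(pair_bigA _ (fun (b : {ffun 'I_N -> C}) c =>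
  (\prod_i w i (b i)) * (w k c * H b)))/=.
by apply: eq_bigr => b _; rewrite -mulr_sumr -mulr_suml w1 mul1r.
Qed.

(** A replacement argument: the [N] random coordinates are exchanged for their means one at a time,
    each exchange costing the exponent of [expR_ratio_resample]. *)
Lemma expR_ratio_product {R : realType} {C : finType} {N : nat}
    (w : 'I_N -> C -> R) (a g : C -> R) (s q b : R) :
  (0 < N)%N -> (forall i c, 0 <= w i c) -> (forall i, \sum_c w i c = 1) ->
  (forall c, 0 < g c) -> (forall c c', g c <= q * g c') ->
  0 <= q -> 0 <= b ->
  (forall c c', `|a c * g c' - a c' * g c| <= b * (g c * g c')) ->
  `|s| * (2 * q * b / N%:R) <= 1 / 3 ->
  \sum_(x : {ffun 'I_N -> C}) (\prod_i w i (x i)) *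
     expR (s * ((\sum_i a (x i)) / (\sum_i g (x i)))) <=
  expR (s * ((\sum_i \sum_c w i c * a c) / (\sum_i \sum_c w i c * g c)) +
    N%:R * (`|s| * (2 * q ^+ 2 * b / N%:R ^+ 2) +
            s ^+ 2 * (2 * q * b / N%:R) ^+ 2)).
Proof.
move=> N0 w0 w1 g0 gq q0 b0 ab hs.
set K := `|s| * _ + _.
(* The first [k] coordinates are still random and the others are averaged: [k = 0] gives the
   deterministic ratio, [k = N] the random one. *)
pose mix h k (x : {ffun 'I_N -> C}) : R :=
  \sum_(i < N) if (i < k)%N then h (x i) else \sum_c w i c * h c.
have W0 (x : {ffun 'I_N -> C}) : 0 <= \prod_i w i (x i) by exact: prodr_ge0.
have sw i (h : C -> R) y : \sum_c w i c * (y * h c) = y * \sum_c w i c * h c.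
  by rewrite mulr_sumr; apply: eq_bigr => c _; rewrite mulrCA.
have wge i (h : C -> R) y : (forall c, y <= h c) -> y <= \sum_c w i c * h c.
  move=> hy; rewrite -[leLHS]mul1r -(w1 i) mulr_suml ler_sum// => c _.
  by rewrite ler_wpM2l.
have Dq k x c : N%:R * g c <= q * mix g k x.
  rewrite -[N in N%:R]card_ord -sum1_card natr_sum mulr_suml mulr_sumr ler_sum//.
  move=> i _; rewrite mul1r; case: ifP => _ //.
  by rewrite -sw; exact: wge.
have NR0 : 0 < N%:R :> R by rewrite ltr0n.
have [c0|nC] := pickP C; last first.
  have : \sum_c w (Ordinal N0) c = 0 by rewrite big_pred0.
  by rewrite w1 => /eqP; rewrite oner_eq0.
move=> _.
have D0 k x : 0 < mix g k x.
  have h : 0 < q * mix g k x by rewrite (lt_le_trans _ (Dq k x c0))// mulr_gt0.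
  by rewrite ltNge; apply/negP => m0; move: h; rewrite ltNge mulr_ge0_le0.
have uD k x c : `|a c * mix g k x - mix a k x * g c| <= b * (g c * mix g k x).
  rewrite mulr_sumr mulr_suml -sumrB !mulr_sumr.
  rewrite (le_trans (ler_norm_sum _ _ _))// ler_sum// => i _.
  case: ifP => _ //.
  rewrite -sw mulr_suml -sumrB -!sw (le_trans (ler_norm_sum _ _ _))//.
  apply: ler_sum => c' _.
  have -> : w i c' * (a c * g c') - w i c' * a c' * g c =
    w i c' * (a c * g c' - a c' * g c) by ring.
  by rewrite normrM (ger0_norm (w0 _ _)) ler_wpM2l.
(* Resampling coordinate [k] adds a centred increment to [mix h k], which is the form required by
   [expR_ratio_resample]. *)
have mixS h (k : 'I_N) (x : {ffun 'I_N -> C}) c :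
    mix h k.+1 [ffun i => if i == k then c else x i] =
    mix h k x + h c - \sum_c w k c * h c.
  rewrite /mix (bigD1 k)//= [in RHS](bigD1 k)//= ltnS leqnn ltnn ffunE eqxx.
  have rr (u v y : R) : u + v + y - u = y + v by ring.
  rewrite rr; congr (_ + _).
  apply: eq_bigr => i ik; rewrite ltnS leq_eqVlt ffunE.
  by have /negbTE -> : nat_of_ord i != k by []; rewrite (negbTE ik).
suff H k : (k <= N)%N -> \sum_(x : {ffun 'I_N -> C}) (\prod_i w i (x i)) *
    expR (s * (mix a k x / mix g k x)) <=
    expR (s * ((\sum_i \sum_c w i c * a c) / (\sum_i \sum_c w i c * g c)) +
    k%:R * K).
  apply: le_trans (H N (leqnn N)).
  have mixN h (x : {ffun 'I_N -> C}) : mix h N x = \sum_i h (x i).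
    by apply: eq_bigr => i _; rewrite ltn_ord.
  by apply: ler_sum => x _; rewrite !mixN.
elim: k => [_|k ih kN].
  rewrite mul0r addr0 /mix/= -mulr_suml.
  rewrite -(bigA_distr_bigA (fun i c => w i c)) big1 ?mul1r// => i _.
rewrite (@sum_prod_resample _ _ _ _ _ (Ordinal kN))//.
have := ih (ltnW kN); rewrite -(ler_pM2l (expR_gt0 K)) -expRD.
set E0 := s * (_ / _).
have -> : K + (E0 + k%:R * K) = E0 + k.+1%:R * K by rewrite -natr1; ring.
apply: le_trans; rewrite mulr_sumr; apply: ler_sum => x _.
rewrite mulrCA ler_wpM2l// -expRD.
under eq_bigr => c _ do rewrite !(mixS _ (Ordinal kN)).
rewrite [leRHS](_ : _ = expR (s * (mix a k x / mix g k x) + K)); last first.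
  by rewrite addrC.
apply: (@expR_ratio_resample R C) => //.
- by move=> c; rewrite ltW.
- by move=> c; rewrite -(mixS _ (Ordinal kN)).
- by move=> c c'; rewrite -(mixS _ (Ordinal kN)).
Qed.

(** * Rounding of bounded functions and control of the error *)

Lemma ler_expR_closure {R : realType} (x z : R) :
  0 <= z -> (forall t, 0 < t -> x <= expR t * z) -> x <= z.
Proof.
rewrite le_eqVlt => /predU1P[<- /(_ _ ltr01)|z0 h]; first by rewrite mulr0.
rewrite leNgt; apply/negP => zx.
have xz : 1 < x / z by rewrite ltr_pdivlMr// mul1r.
have := h (ln (x / z) / 2); rewrite divr_gt0 ?ln_gt0// => /(_ isT).
rewrite -ler_pdivrMr// leNgt => /negP; apply.
rewrite -[ltRHS]lnK ?posrE ?(lt_trans _ xz)// ltr_expR.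
by have := ln_gt0 xz; lra.
Qed.

(** The cells are preimages of consecutive intervals of length [e]; boundedness of [h] leaves
    finitely many of them. *)
Lemma bdm_cells {R : realType} {d} {T : measurableType d} (h : T -> R) (e : R) :
  bdm h -> 0 < e -> exists K (cell : T -> 'I_K),
    (forall k, measurable (cell @^-1` [set k])) /\
    (forall x y, cell x = cell y -> `|h x - h y| <= e).
Proof.
move=> [mh [c hc]] e0.
pose t x := (h x + c) / e.
have t0 x : 0 <= t x.
  by rewrite divr_ge0 ?(ltW e0)//; have := hc x; rewrite ler_norml => /andP[? _]; lra.
have tK x : (Num.truncn (t x) <= Num.truncn (2 * c / e))%N.
  apply: le_truncn; rewrite ler_pM2r ?invr_gt0//.
  by have := hc x; rewrite ler_norml => /andP[_ ?]; lra.
pose cell x : 'I_(Num.truncn (2 * c / e)).+1 := inord (Num.truncn (t x)).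
have cellE x k : (cell x = k) <-> (k%:R <= t x < k.+1%:R).
  split => [<-|]; first by rewrite inordK ?ltnS// truncn_itv.
  by move=> /truncn_def tk; apply/val_inj; rewrite /= inordK ?ltnS.
exists _, cell; split => [k|x y cxy].
  rewrite (_ : _ @^-1` _ = h @^-1` `[k%:R * e - c, k.+1%:R * e - c[).
    by rewrite -[X in measurable X]setTI; exact: mh.
  apply/seteqP; split => x /=; rewrite in_itv/=.
    move=> /cellE; rewrite /t ler_pdivlMr// ltr_pdivrMr// => /andP[h1 h2].
    by rewrite lerBlDr h1 ltrBrDr h2.
  move=> /andP[h1 h2]; apply/cellE; rewrite /t ler_pdivlMr// ltr_pdivrMr//.
  by rewrite -lerBlDr h1 -ltrBrDr h2.
have /cellE := erefl (cell x); have /cellE := esym cxy.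
move: (nat_of_ord (cell x)) => k.
rewrite -!natr1 /t !ler_pdivlMr// !ltr_pdivrMr// ler_norml !mulrDl !mul1r.
by move=> /andP[? ?] /andP[? ?]; apply/andP; split; lra.
Qed.

(** All bounds scale with [n], which cancels: the error on a ratio of sums over [n] particles
    depends on [e], [lo] and [c] alone. *)
Lemma ratio_approx {R : realType} (A A' D D' n lo c e : R) :
  0 < n -> 0 < lo -> n * lo <= D -> n * lo <= D' -> `|A'| <= n * c ->
  `|A - A'| <= n * e -> `|D - D'| <= n * e ->
  `|A / D - A' / D'| <= e * (lo^-1 + c / lo ^+ 2).
Proof.
move=> n0 lo0 hD hD' hA' hA hDD.
have nlo : 0 < n * lo by rewrite mulr_gt0.
have D0 := lt_le_trans nlo hD; have D'0 := lt_le_trans nlo hD'.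
have e0 : 0 <= n * e by exact: le_trans hA.
have c0 : 0 <= n * c by exact: le_trans hA'.
have -> : A / D - A' / D' = (A - A') / D + A' * (D' - D) / (D * D').
  by field; rewrite !gt_eqF.
have -> : e * (lo^-1 + c / lo ^+ 2) =
   n * e / (n * lo) + n * c * (n * e) / (n * lo * (n * lo)).
  by field; rewrite !gt_eqF.
rewrite (le_trans (ler_normD _ _))// !normrM !normfV !normrM.
rewrite [`|D' - D|]distrC (gtr0_norm D0) (gtr0_norm D'0).
apply: lerD.
  by apply: ler_pM => //; [rewrite invr_ge0 ltW | rewrite lef_pV2].
apply: ler_pM.
- exact: mulr_ge0.
- by rewrite invr_ge0 mulr_ge0// ltW.
- exact: ler_pM.
- by rewrite lef_pV2 ?posrE ?mulr_gt0// ler_pM// ltW.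
Qed.

(** * Exponential moment of one generation through its conditional laws *)

Section LaplaceStep.
Context {R : realType} {dO d : measure_display} {Omega : measurableType dO}
  {T : measurableType d} {N : nat}.
Variables (P : probability Omega R) (Y : 'I_N -> Omega -> T)
  (L : Omega -> 'I_N -> (T -> R) -> R).
Hypotheses (N0 : (0 < N)%N) (mY : forall i, measurable_fun setT (Y i))
  (mL : forall w i, is_mean (L w i))
  (measL : forall i h, bdm h -> measurable_fun setT (fun w => L w i h))
  (lawY : forall B : 'I_N -> set T, (forall i, measurable (B i)) ->
    P (\bigcap_(i in setT) [set w | B i (Y i w)]) =
    (\int[P]_w (\prod_i L w i (\1_(B i)))%:E)%E).

Let E f := Rintegral P setT f.

Let mE : is_mean E.
Proof. by apply: Rintegral_mean; exact: probability_setT. Qed.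

Let bdmL i h : bdm h -> bdm (fun w => L w i h).
Proof.
move=> bh; have [_ [c hc]] := bh.
by split; [exact: measL | exists c => w; exact: mean_norm].
Qed.

(** A function of the cells is a finite combination of indicators of rectangles, the events on which
    [lawY] describes the joint law. *)
Lemma law_cells {C : finType} (cell : T -> C) (F : {ffun 'I_N -> C} -> R) :
  (forall c, measurable (cell @^-1` [set c])) ->
  E (fun w => F [ffun i => cell (Y i w)]) =
  E (fun w => \sum_(x : {ffun 'I_N -> C})
    (\prod_i L w i (\1_(cell @^-1` [set x i]))) * F x).
Proof.
move=> mcell.
pose A (x : {ffun 'I_N -> C}) :=
  \bigcap_(i in [set: 'I_N]) [set w | (cell @^-1` [set x i]) (Y i w)].
have mA x : measurable (A x).
  apply: fin_bigcap_measurable => // i _.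
  by rewrite -[X in measurable X]setTI; exact: mY.
have -> : (fun w => F [ffun i => cell (Y i w)]) =
    (fun w => \sum_(x : {ffun 'I_N -> C}) F x * \1_(A x) w).
  apply/funext => w; rewrite (bigD1 [ffun i => cell (Y i w)])//= indicE mem_set.
    rewrite mulr1 big1 ?addr0// => x xn; rewrite indicE memNset ?mulr0//.
    move=> Ax; move/eqP: xn; apply; apply/ffunP => i; rewrite ffunE.
    by have := Ax i I => /= ->.
  by move=> i _ /=; rewrite ffunE.
have bprod x : bdm (fun w => \prod_i L w i (\1_(cell @^-1` [set x i]) : T -> R)).
  by apply: bdm_prod => i; apply: bdmL; exact: bdm_indic.
rewrite !(mean_sum _ mE); last 2 first.
- by move=> x; apply: bdmM => //; exact: bdm_cst.
- by move=> x; apply: bdmZ; exact: bdm_indic.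
apply: eq_bigr => x _; rewrite (meanZ _ mE); last exact: bdm_indic.
have -> : E (fun w => \prod_i L w i (\1_(cell @^-1` [set x i])) * F x) =
    F x * E (fun w => \prod_i L w i (\1_(cell @^-1` [set x i]))).
  by rewrite -(meanZ _ mE)//; congr E; apply/funext => w; rewrite mulrC.
rewrite /E Rintegral_indic//; congr (_ * fine _).
exact: (lawY (fun i => cell @^-1` [set x i])).
Qed.

(* [a] and [g] are rounded to finitely many values (those at representatives of
   the cells), so that only the finite product law on cells is needed; the
   rounding error is then sent to zero. *)
Lemma laplace_step (x0 : T) (a g : T -> R) (s q b : R) :
  bdm a -> bdm g ->
  (forall x, 0 < g x) -> (forall x y, g x <= q * g y) -> 0 <= b ->
  (forall x y, `|a x * g y - a y * g x| <= b * (g x * g y)) ->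
  `|s| * (2 * q * b / N%:R) <= 1 / 3 ->
  E (fun w => expR (s * ((\sum_i a (Y i w)) / (\sum_i g (Y i w))))) <=
  expR (N%:R * (`|s| * (2 * q ^+ 2 * b / N%:R ^+ 2) +
            s ^+ 2 * (2 * q * b / N%:R) ^+ 2)) *
  E (fun w => expR (s * ((\sum_i L w i a) / (\sum_i L w i g)))).
Proof.
set K := N%:R * _.
move=> ba bg g0 gq b0 ab hs.
have q0 : 0 < q.
  by have := gq x0 x0; rewrite -ler_pdivrMr// divff ?gt_eqF// => /(lt_le_trans ltr01).
have NR0 : 0 < N%:R :> R by rewrite ltr0n.
pose lo := g x0 / q.
have lo0 : 0 < lo by rewrite divr_gt0.
have glo x : lo <= g x by rewrite /lo ler_pdivrMr// mulrC.
have [ma [ca hca]] := ba.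
have sumlo (f : 'I_N -> R) : (forall i, lo <= f i) -> N%:R * lo <= \sum_i f i.
  move=> h; rewrite -[N in N%:R]card_ord -sum1_card natr_sum mulr_suml.
  by apply: ler_sum => i _; rewrite mul1r.
have sumnorm (f : 'I_N -> R) y : (forall i, `|f i| <= y) ->
    `|\sum_i f i| <= N%:R * y.
  move=> h; rewrite -[N in N%:R]card_ord -sum1_card natr_sum mulr_suml.
  by rewrite (le_trans (ler_norm_sum _ _ _))// ler_sum// => i _; rewrite mul1r.
have bsum (F : Omega -> 'I_N -> (T -> R) -> R) : 
    (forall i h, bdm h -> bdm (fun w => F w i h)) ->
    (forall w i, lo <= F w i g) ->
    bdm (fun w => expR (s * ((\sum_i F w i a) / (\sum_i F w i g)))).
  move=> bF hF; apply: bdm_expR; apply: bdmZ; apply: bdmM.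
    by apply: bdm_sum => i; exact: bF.
  apply: (bdmV (N%:R * lo)); [|by rewrite mulr_gt0|by move=> w; exact: sumlo].
  by apply: bdm_sum => i; exact: bF.
have bX : bdm (fun w => expR (s * ((\sum_i a (Y i w)) / (\sum_i g (Y i w))))).
  by apply: (bsum (fun w i h => h (Y i w))) => // i h bh; exact: bdm_comp.
have Lg w i : lo <= L w i g by exact: mean_ge.
have bL : bdm (fun w => expR (s * ((\sum_i L w i a) / (\sum_i L w i g)))).
  exact: bsum.
apply: ler_expR_closure => [|t t0].
  by rewrite mulr_ge0 ?expR_ge0// (mean_ge0 _ mE)// => w; exact: expR_ge0.
pose c1 := lo^-1 + ca / lo ^+ 2.
have ca0 : 0 <= ca by exact: le_trans (hca x0).
have c10 : 0 <= c1 by rewrite addr_ge0 ?divr_ge0 ?sqr_ge0 ?invr_ge0// ltW.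
(* Rounding is paid twice, for the particles and for their conditional means, each time with
   [|s| * (e * c1)] in the exponent; this [e] keeps the total below [t], and the [+ 1] covers
   [s = 0]. *)
pose e := t / (2 * (`|s| * c1 + 1)).
have sc0 : 0 <= `|s| * c1 by rewrite mulr_ge0.
have e0 : 0 < e by rewrite divr_gt0//; lra.
have set2 : `|s| * (e * c1) + `|s| * (e * c1) <= t.
  rewrite /e; have -> : `|s| * (t / (2 * (`|s| * c1 + 1)) * c1) +
    `|s| * (t / (2 * (`|s| * c1 + 1)) * c1) = t * (`|s| * c1) / (`|s| * c1 + 1).
    by field; rewrite gt_eqF//; lra.
  by rewrite ler_pdivrMr ?ler_pM2l//; lra.
have [Ka [cella [mcella hcella]]] := bdm_cells a e ba e0.
have [Kg [cellg [mcellg hcellg]]] := bdm_cells g e bg e0.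
pose cell x := (cella x, cellg x).
have mcell c : measurable (cell @^-1` [set c]).
  rewrite (_ : _ @^-1` _ = cella @^-1` [set c.1] `&` cellg @^-1` [set c.2]).
    exact: measurableI.
  apply/seteqP; split => [x /= <-//|x [/= c1E c2E]].
  by rewrite /cell c1E c2E; case: (c).
(* One representative per cell, [x0] for an empty one. Being values at points of [T], [a \o z] and
   [g \o z] inherit the comparison and oscillation bounds. *)
pose z c := xget x0 (cell @^-1` [set c]).
have cellz x : cell (z (cell x)) = cell x.
  by rewrite /z; case: xgetP => [y _ /= ->|/(_ x) []].
have za x : `|a x - a (z (cell x))| <= e.
  by apply: hcella; have := cellz x; case.
have zg x : `|g x - g (z (cell x))| <= e.
  by apply: hcellg; have := cellz x; case.
pose Ft (x : {ffun 'I_N -> 'I_Ka * 'I_Kg}) : R :=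
  (\sum_i a (z (x i))) / (\sum_i g (z (x i))).
have sapprox (u v : R) : `|u - v| <= e * c1 -> s * u <= `|s| * (e * c1) + s * v.
  move=> uv; rewrite -lerBlDr -mulrBr (le_trans (ler_norm _))// normrM.
  exact: ler_wpM2l.
have step1 w : expR (s * ((\sum_i a (Y i w)) / (\sum_i g (Y i w)))) <=
    expR (`|s| * (e * c1)) * expR (s * Ft [ffun i => cell (Y i w)]).
  rewrite -expRD ler_expR; apply: sapprox; rewrite /Ft.
  apply: (ratio_approx _ _ _ _ N%:R) => //.
  - exact: sumlo.
  - exact: sumlo.
  - exact: sumnorm.
  - by rewrite -sumrB; apply: sumnorm => i; rewrite ffunE.
  - by rewrite -sumrB; apply: sumnorm => i; rewrite ffunE.
have Lsum (h : 'I_Ka * 'I_Kg -> R) w i :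
    \sum_c L w i (\1_(cell @^-1` [set c])) * h c = L w i (fun y => h (cell y)).
  have bc c : bdm (\1_(cell @^-1` [set c]) : T -> R) by exact: bdm_indic.
  transitivity (L w i (fun y => \sum_c h c * \1_(cell @^-1` [set c]) y)).
    rewrite (mean_sum _ (mL w i)); last by move=> c; exact: bdmZ.
    by apply: eq_bigr => c _; rewrite (meanZ _ (mL w i))// mulrC.
  congr (L w i); apply/funext => y; rewrite (bigD1 (cell y))//= indicE mem_set//.
  rewrite mulr1 big1 ?addr0// => c cn; rewrite indicE memNset ?mulr0//=.
  by move=> cE; rewrite cE eqxx in cn.
have bz (h : 'I_Ka * 'I_Kg -> R) : bdm (fun y => h (cell y)).
  rewrite (_ : (fun _ => _) =
      fun y => \sum_c h c * (\1_(cell @^-1` [set c]) : T -> R) y).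
    by apply: bdm_sum => c; apply: bdmZ; exact: bdm_indic.
  apply/funext => y; rewrite (bigD1 (cell y))//= indicE mem_set//.
  rewrite mulr1 big1 ?addr0// => c cn; rewrite indicE memNset ?mulr0//=.
  by move=> cE; rewrite cE eqxx in cn.
have bza : bdm (fun y => a (z (cell y))) by exact: (bz (a \o z)).
have bzg : bdm (fun y => g (z (cell y))) by exact: (bz (g \o z)).
have step2 w : \sum_(x : {ffun 'I_N -> 'I_Ka * 'I_Kg})
    (\prod_i L w i (\1_(cell @^-1` [set x i]))) * expR (s * Ft x) <=
    expR (`|s| * (e * c1) + K) *
    expR (s * ((\sum_i L w i a) / (\sum_i L w i g))).
  rewrite -expRD.
  apply: (@le_trans _ _ _ _ _ (expR_ratio_product
    (fun i c => L w i (\1_(cell @^-1` [set c]))) (a \o z) (g \o z) s q b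
    N0 _ _ _ _ _ _ _ _)) => //=.
  - by move=> i c; apply: (mean_ge0 _ (mL w i)); first exact: bdm_indic.
  - move=> i; have := Lsum (fun=> 1) w i; rewrite (mean_cst _ (mL w i)) => <-.
    by apply: eq_bigr => c _; rewrite mulr1.
  - exact: ltW.
  rewrite ler_expR -/K addrAC lerD2r.
  under eq_bigr => i _ do rewrite (Lsum (a \o z)).
  under [X in _ / X]eq_bigr => i _ do rewrite (Lsum (g \o z)).
  apply: sapprox; apply: (ratio_approx _ _ _ _ N%:R) => //.
  - by apply: sumlo => i; apply: (mean_ge _ (mL w i)) => // x; exact: glo.
  - exact: sumlo.
  - by apply: sumnorm => i; exact: (mean_norm _ (mL w i)).
  - rewrite -sumrB; apply: sumnorm => i; rewrite -(meanB _ (mL w i))//.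
    apply: (mean_norm _ (mL w i)); first exact: bdmB.
    by move=> y; rewrite distrC; exact: za.
  - rewrite -sumrB; apply: sumnorm => i; rewrite -(meanB _ (mL w i))//.
    apply: (mean_norm _ (mL w i)); first exact: bdmB.
    by move=> y; rewrite distrC; exact: zg.
have bF : bdm (fun w => expR (s * Ft [ffun i => cell (Y i w)])).
  under eq_fun => w.
    rewrite /Ft; under eq_bigr do rewrite ffunE.
    under [X in _ / X]eq_bigr do rewrite ffunE.
    over.
  apply: bdm_expR; apply: bdmZ; apply: bdmM.
    by apply: bdm_sum => i; exact: (bdm_comp (Y i)) (mY i) bza.
  apply: (bdmV (N%:R * lo)); [|by rewrite mulr_gt0|by move=> w; exact: sumlo].
  by apply: bdm_sum => i; exact: (bdm_comp (Y i)) (mY i) bzg.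
have le1 := mean_le _ mE _ _ bX (bdmZ (expR (`|s| * (e * c1))) _ bF) step1.
apply: (le_trans le1); rewrite (meanZ _ mE)//.
rewrite (law_cells cell (fun x => expR (s * Ft x)))//.
rewrite mulrA -expRD [expR (t + K)]expRD.
have bS : bdm (fun w => \sum_(x : {ffun 'I_N -> 'I_Ka * 'I_Kg})
    (\prod_i L w i (\1_(cell @^-1` [set x i]) : T -> R)) * expR (s * Ft x)).
  apply: bdm_sum => x; apply: bdmM; last exact: bdm_cst.
  by apply: bdm_prod => i; apply: bdmL; exact: bdm_indic.
have le2 := mean_le _ mE _ _ bS (bdmZ _ _ bL) step2.
apply: (le_trans (ler_wpM2l (expR_ge0 _) le2)).
rewrite (meanZ _ mE)// mulrA -expRD ler_wpM2r//.
  by apply: (mean_ge0 _ mE) => // w; exact: expR_ge0.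
by rewrite -expRD ler_expR addrA lerD2r.
Qed.

End LaplaceStep.

(** * Measurability of kernel integrals depending on a parameter *)

Section KernelPullback.
Context {d1 d2 d3 : measure_display} {Z : measurableType d1}
  {X : measurableType d2} {Y : measurableType d3} {R : realType}.
Variables (l : R.-pker X ~> Y) (h : Z -> X) (mh : measurable_fun setT h).

(** The measurability proof is an argument so that the kernel structure declared below can be
    attached to the term. *)
Definition kernel_pullback of measurable_fun setT h :
  Z -> {measure set Y -> \bar R} := fun z => l (h z).

Let measurable_pullback U : measurable U ->
  measurable_fun setT (fun z => kernel_pullback mh z U).
Proof.
by move=> mU; apply: (measurableT_comp (measurable_kernel l U mU) mh).
Qed.

HB.instance Definition _ :=
  isKernel.Build _ _ Z Y R (kernel_pullback mh) measurable_pullback.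

Let pullback_setT z : kernel_pullback mh z setT = 1%E.
Proof. exact: prob_kernel. Qed.

HB.instance Definition _ :=
  Kernel_isProbability.Build _ _ Z Y R (kernel_pullback mh) pullback_setT.

Lemma bdm_kernel_integral (k : Z * Y -> R) : bdm k ->
  bdm (fun z => Rintegral (l (h z)) setT (fun y => k (z, y))).
Proof.
move=> [mk [c hc]].
have bk z : bdm (fun y => k (z, y)).
  by split; [exact: measurable_fun_pair2 | exists c => y].
have mean z := Rintegral_mean (l (h z)) (prob_kernel (h z)).
split; last by exists c => z; apply: (mean_norm _ (mean z)).
(* The shift by [c] makes the integrand nonnegative, so that measurability of nonnegative kernel
   integrals applies; it is subtracted afterwards. *)
have k0 z : 0 <= k z + c by have := hc z; rewrite ler_norml => /andP[? _]; lra.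
rewrite (_ : (fun _ => _) = fun z =>
    fine (\int[kernel_pullback mh z]_y (k (z, y) + c)%:E)%E - c).
  apply: measurable_funB; last exact: measurable_cst.
  apply: measurableT_comp => //.
  apply: (measurable_fun_integral_sfinite_kernel (fun z => (k z + c)%:E)).
    by move=> z; rewrite lee_fin.
  by apply/measurable_EFinP; apply: measurable_funD => //; exact: measurable_cst.
apply/funext => z; have := meanD _ (mean z) _ _ (bk z) (bdm_cst c).
by rewrite (mean_cst _ (mean z)) /Rintegral => ->; rewrite addrK.
Qed.

End KernelPullback.

Lemma probability_inhabited {d} {T : measurableType d} {R : realType}
  (mu : {measure set T -> \bar R}) : mu setT = 1%E -> inhabited T.
Proof.
move=> mu1; apply: contrapT => nT; suff T0 : [set: T] = set0.
  by move: mu1; rewrite T0 measure0 => /eqP; rewrite eqe eq_sym oner_eq0.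
by rewrite -subset0 => x _; apply: nT; exact: inhabits.
Qed.

Definition bounded_below {R : realType} {T : Type} (f : T -> R) : Prop :=
  exists2 lo, 0 < lo & forall x, lo <= f x.

Lemma bounded_below_gt0 {R : realType} {T : Type} (f : T -> R) x :
  bounded_below f -> 0 < f x.
Proof. by move=> [lo lo0 /(_ x)]; exact: lt_le_trans. Qed.

(** * The Feynman-Kac semigroup for an arbitrary potential *)

Section Semigroup.
Context {R : realType} {d : nat -> measure_display}
  {S : forall n, measurableType (d n)}.
Variable M : forall n, R.-pker S n ~> S n.+1.
Implicit Types (H : forall n, S n -> R).

Local Notation Q := (@Defs.Qpn R d S M).
Local Notation cast := (@Defs.tcast R d S).

Lemma Mint_mean {n} (x : S n) : is_mean (fun f => Mint M x f).
Proof. exact/Rintegral_mean/prob_kernel. Qed.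

Lemma bdm_Mint {n} (f : S n.+1 -> R) : bdm f -> bdm (fun x => Mint M x f).
Proof.
move=> bf; apply: (bdm_kernel_integral (M n) idfun _ (fun z => f z.2)).
  exact: measurable_id.
exact: (bdm_comp snd f measurable_snd bf).
Qed.

Lemma tcast_id n (f : S n -> R) : cast n n f = f.
Proof. by rewrite /Defs.tcast; case: eqP => // e; rewrite (eq_axiomK e). Qed.

(** [Qf] recurses on the final time; this is the recursion on the initial time, along which the
    later inductions run. *)
Lemma Qf_bottom H p k (f : S (k.+1 + p) -> R) :
  Defs.Qf R d S M H p k.+1 f = fun x => H p x *
    Mint M x (Defs.Qf R d S M H p.+1 k (cast (k.+1 + p) (k + p.+1) f)).
Proof.
elim: k f => [|k ih] f /=; first by rewrite tcast_id.
rewrite [LHS]ih; apply/funext => x; congr (_ * Mint M x _).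
rewrite /=; congr (Defs.Qf _ _ _ _ _ _ _ _).
(* Once one of the two equal indices is generalised, the casts become identities. *)
have e : (k.+1 + p = k + p.+1)%N by rewrite addnS.
move: f; change (k.+2 + p)%N with (k.+1 + p).+1.
move: (k.+1 + p)%N e => m ->{m} f.
by rewrite !tcast_id.
Qed.

Lemma QpnE H p k n (f : S n -> R) : (k + p = n)%N ->
  Q H p n f = Defs.Qf R d S M H p k (cast n (k + p) f).
Proof.
move=> e; subst n; rewrite /Defs.Qpn.
by move: (k + p - p)%N (addnK p k) => j ->.
Qed.

Lemma Qpn_id H n (f : S n -> R) : Q H n n f = f.
Proof. by rewrite (QpnE H n 0 n f erefl) tcast_id. Qed.

Lemma Qpn_step H p n (f : S n -> R) : (p < n)%N ->
  Q H p n f = fun x => H p x * Mint M x (Q H p.+1 n f).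
Proof.
move=> pn; have e : ((n - p.+1).+1 + p = n)%N by rewrite addSnnS subnK.
rewrite (QpnE H p _ n f e) Qf_bottom.
have e' : (n - p.+1 + p.+1 = n)%N by rewrite subnK.
rewrite (QpnE H p.+1 _ n f e').
move: (n - p.+1)%N e e' => k e; subst n => _.
by rewrite tcast_id.
Qed.

(** Downward induction from [n], the direction in which [Qpn_step] unfolds the semigroup. *)
Lemma Qpn_ind (A : nat -> Prop) n : A n ->
  (forall p, (p < n)%N -> A p.+1 -> A p) -> forall p, (p <= n)%N -> A p.
Proof.
move=> An AS p pn; rewrite -(subKn pn).
elim: (n - p)%N (leq_subr p n) => [_|k ih kn]; first by rewrite subn0.
apply: AS; first by rewrite ltn_subrL (leq_trans _ kn).
by rewrite -subSn// subSS; exact/ih/ltnW.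
Qed.

Lemma Qpn_comp H p e n (f : S n -> R) : (p <= e)%N -> (e <= n)%N ->
  Q H p n f = Q H p e (Q H e n f).
Proof.
move=> + en; move: p; apply: Qpn_ind => [|p pe ih]; first by rewrite Qpn_id.
by rewrite Qpn_step ?(leq_trans pe)// ih [RHS]Qpn_step.
Qed.

Lemma bdm_Qpn H p n (f : S n -> R) : (forall j, bdm (H j)) -> bdm f ->
  (p <= n)%N -> bdm (Q H p n f).
Proof.
move=> bH bf; move: p; apply: Qpn_ind => [|p pn ih]; first by rewrite Qpn_id.
by rewrite Qpn_step//; apply: bdmM => //; exact: bdm_Mint.
Qed.

Lemma Qpn_lin H p n c (f g : S n -> R) : (forall j, bdm (H j)) ->
  bdm f -> bdm g -> (p <= n)%N ->
  Q H p n (fun x => c * f x + g x) = fun x => c * Q H p n f x + Q H p n g x.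
Proof.
move=> bH bf bg; move: p; apply: Qpn_ind => [|p pn ih]; first by rewrite !Qpn_id.
rewrite !(Qpn_step H p n)// ih; apply/funext => x.
by rewrite (mean_lin _ (Mint_mean x)); [ring | exact: bdm_Qpn..].
Qed.

Lemma Qpn_ge0 H p n (f : S n -> R) : (forall j, bdm (H j)) ->
  (forall j x, 0 <= H j x) -> bdm f -> (forall x, 0 <= f x) -> (p <= n)%N ->
  forall x, 0 <= Q H p n f x.
Proof.
move=> bH H0 bf f0; move: p; apply: Qpn_ind => [|p pn ih]; first by rewrite Qpn_id.
move=> x; rewrite Qpn_step// mulr_ge0// (mean_ge0 _ (Mint_mean x))//.
exact: bdm_Qpn.
Qed.

Lemma Qpn_const p n (f : S n -> R) : (forall x, f x = 1) -> (p <= n)%N ->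
  forall x, Q (fun _ _ => 1) p n f x = 1.
Proof.
move=> f1; move: p; apply: Qpn_ind => [|p pn ih]; first by rewrite Qpn_id.
move=> x; rewrite Qpn_step// mul1r.
by rewrite (_ : Q _ _ _ _ = fun=> 1) ?(mean_cst _ (Mint_mean x))//; exact/funext.
Qed.

(** The mutation semigroup is the case of potential 1, which lets [condM] be read in terms of
    [Qpn]. *)
Lemma Mf_Qpn p m (f : S (m + p) -> R) :
  Defs.Mf R d S M p m f = Q (fun _ _ => 1) p (m + p) f.
Proof.
rewrite (QpnE _ p m (m + p) f erefl) tcast_id.
elim: m f => [//|m ih] f /=; rewrite ih; congr (Defs.Qf _ _ _ _ _ _ _ _).
by apply/funext => x; rewrite mul1r.
Qed.

Lemma Qpn_bounded_below H p n : (forall j, bdm (H j)) ->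
  (forall j, bounded_below (H j)) -> (p <= n)%N ->
  bounded_below (Q H p n (fun=> 1)).
Proof.
move=> bH H0; move: p; apply: Qpn_ind => [|p pn [lo lo0 loQ]].
  by rewrite Qpn_id; exists 1.
have bQ : bdm (Q H p.+1 n (fun=> 1)) by apply: bdm_Qpn => //; exact: bdm_cst.
have [lo' lo'0 loH] := H0 p; rewrite Qpn_step//.
exists (lo' * lo); first exact: mulr_gt0.
by move=> x; rewrite ler_pM ?(ltW lo0) ?(ltW lo'0)//; exact: (mean_ge _ (Mint_mean x)).
Qed.

Section Positive.
Variable H : forall n, S n -> R.
Hypotheses (bH : forall j, bdm (H j)) (H0 : forall j, bounded_below (H j)).

Let Hpos j x : 0 < H j x. Proof. exact: bounded_below_gt0. Qed.

Lemma Qpn1_gt0 p n : (p <= n)%N -> forall x, 0 < Q H p n (fun=> 1) x.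
Proof. by move=> pn x; apply: bounded_below_gt0; exact: Qpn_bounded_below. Qed.

Lemma bdm_Qpn1 p n : (p <= n)%N -> bdm (Q H p n (fun=> 1)).
Proof. by move=> pn; apply: bdm_Qpn => //; exact: bdm_cst. Qed.

Lemma Ppn_mean p n : (p <= n)%N ->
  forall x, is_mean (fun f => Defs.Ppn R d S M H p n f x).
Proof.
move=> pn x; have Q0 := Qpn1_gt0 _ _ pn x; split; rewrite /Defs.Ppn.
- by rewrite divff// gt_eqF.
- by move=> c f g bf bg; rewrite Qpn_lin// mulrDl mulrA.
- move=> f bf f0; rewrite divr_ge0 ?(ltW Q0)//.
  by apply: Qpn_ge0 => // j y; exact/ltW/Hpos.
Qed.

Variable eta0 : probability (S 0) R.

Lemma etaFK_mean n : is_mean (etaFK eta0 M H (n := n)).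
Proof.
elim: n => [|n ih] /=; first exact/Rintegral_mean/probability_setT.
have e0 : 0 < etaFK eta0 M H (H n).
  have [lo lo0 loH] := H0 n.
  by rewrite (lt_le_trans lo0)//; exact: (mean_ge _ ih).
split.
- rewrite (_ : (fun x => _) = H n) ?divff ?gt_eqF//.
  by apply/funext => x; rewrite (mean_cst _ (Mint_mean x)) mulr1.
- move=> c f g bf bg.
  have bM h : bdm h -> bdm (fun x => H n x * Mint M x h).
    by move=> bh; apply: bdmM => //; exact: bdm_Mint.
  rewrite (_ : (fun x => _) = fun x =>
      c * (H n x * Mint M x f) + H n x * Mint M x g).
    by rewrite (mean_lin _ ih)//; [rewrite mulrDl mulrA | exact: bM..].
  apply/funext => x; rewrite (mean_lin _ (Mint_mean x))//; ring.
- move=> f bf f0; rewrite divr_ge0 ?(ltW e0)// (mean_ge0 _ ih)//.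
    by apply: bdmM => //; exact: bdm_Mint.
  by move=> x; rewrite mulr_ge0// ?(ltW (Hpos _ _))// (mean_ge0 _ (Mint_mean x)).
Qed.

(** From [p.+1] to [p], numerator and denominator lose the same factor, the value of [etaFK] at
    [H p]. At [p = 0] the limit is expressed through the initial law. *)
Lemma etaFK_ratio p n (f : S n -> R) : bdm f -> (p <= n)%N ->
  etaFK eta0 M H (Q H p n f) / etaFK eta0 M H (Q H p n (fun=> 1)) =
  etaFK eta0 M H f.
Proof.
move=> bf; move: p; apply: Qpn_ind => [|p pn <-].
  by rewrite !Qpn_id (mean_cst _ (etaFK_mean n)) divr1.
rewrite !(Qpn_step H p n)//=.
have eta_gt0 j h : bdm h -> bounded_below h -> 0 < etaFK eta0 M H (n := j) h.
  move=> bh [lo lo0 loh]; apply: (lt_le_trans lo0).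
  exact: (mean_ge _ (etaFK_mean j)).
have e1 := eta_gt0 _ _ (bH p) (H0 p).
have e2 := eta_gt0 _ _ (bdm_Qpn1 _ _ (ltnW pn))
  (Qpn_bounded_below _ _ _ bH H0 (ltnW pn)).
rewrite (Qpn_step H p n)// in e2.
by field; rewrite !gt_eqF.
Qed.

End Positive.
End Semigroup.

(* The selection-mutation law of one particle, as a functional: [L j] is the
   mutation applied to the [j]-th particle and [g j] its potential. *)
Definition select_mean {R : realType} {T : Type} {N : nat} (g : 'I_N -> R)
    (L : 'I_N -> (T -> R) -> R) (i : 'I_N) (h : T -> R) : R :=
  g i * L i h + (1 - g i) * ((\sum_j g j * L j h) / \sum_j g j).

Lemma select_meanP {R : realType} {d} {T : measurableType d} {N : nat}
    (g : 'I_N -> R) (L : 'I_N -> (T -> R) -> R) :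
  (forall i, 0 < g i < 1) -> (forall i, is_mean (L i)) ->
  forall i, is_mean (select_mean g L i).
Proof.
move=> g01 mL i.
have g0 j : 0 < g j by have /andP[] := g01 j.
have g1 : 0 <= 1 - g i by have /andP[_] := g01 i; rewrite subr_ge0 => /ltW.
have sg : 0 < \sum_j g j.
  rewrite (bigD1 i)//= ltr_wpDr// sumr_ge0// => j _; exact: ltW.
split.
- rewrite /select_mean; under eq_bigr do rewrite (mean_cst _ (mL _)) mulr1.
  by rewrite divff ?gt_eqF// (mean_cst _ (mL i)) !mulr1; ring.
- move=> c h k bh bk; rewrite /select_mean (mean_lin _ (mL i))//.
  have -> : \sum_j g j * L j (fun x => c * h x + k x) =
      c * (\sum_j g j * L j h) + \sum_j g j * L j k.
    rewrite mulr_sumr -big_split/=; apply: eq_bigr => j _.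
    by rewrite (mean_lin _ (mL j))//; ring.
  ring.
- move=> h bh h0; rewrite /select_mean addr_ge0//.
    by rewrite mulr_ge0 ?(ltW (g0 i))// (mean_ge0 _ (mL i)).
  rewrite mulr_ge0// divr_ge0 ?(ltW sg)// sumr_ge0// => j _.
  by rewrite mulr_ge0 ?(ltW (g0 j))// (mean_ge0 _ (mL j)).
Qed.

(** The kept parts sum to [\sum_j g j] times the final ratio and the others to [N] minus that sum
    times it. This is why replacing particles by their conditional laws turns the ratio of one
    generation into that of the previous one. *)
Lemma sum_select_mean {R : realType} {T : Type} {N : nat}
    (g : 'I_N -> R) (L : 'I_N -> (T -> R) -> R) (h : T -> R) :
  0 < \sum_j g j ->
  \sum_i select_mean g L i h = N%:R * ((\sum_j g j * L j h) / \sum_j g j).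
Proof.
move=> sg; rewrite big_split/= -mulr_suml sumrB sumr_const card_ord.
by rewrite -[1 *+ N]/(N%:R) mulrBl; field; rewrite gt_eqF.
Qed.

(** * Exponential moments of the particle system, generation by generation *)

Section Particles.
Context {R : realType} {d : nat -> measure_display}
  {S : forall n, measurableType (d n)}.
Variables (eta0 : probability (S 0) R) (M : forall n, R.-pker S n ~> S n.+1)
  (G : forall n, S n -> R).
Hypotheses (G01 : forall n x, 0 < G n x < 1) (bG : forall n, bdm (G n))
  (G0 : forall n, bounded_below (G n)).
Variables (N : nat) (dO : measure_display) (Omega : measurableType dO)
  (P : probability Omega R) (X : forall n, 'I_N -> Omega -> S n).
Hypotheses (N0 : (0 < N)%N) (PX : particle_system eta0 M G P X).
Variables (n : nat) (f : S n -> R) (q b : nat -> R) (s : R).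
Local Notation Q := (@Defs.Qpn R d S M G).
Hypotheses (bf : bdm f)
  (qP : forall p, (p <= n)%N -> forall x y,
    Q p n (fun=> 1) x <= q p * Q p n (fun=> 1) y)
  (b0 : forall p, (p <= n)%N -> 0 <= b p)
  (bP : forall p, (p <= n)%N -> forall x y,
    `|Defs.Ppn R d S M G p n f x - Defs.Ppn R d S M G p n f y| <= b p)
  (sP : forall p, (p <= n)%N -> `|s| * (2 * q p * b p / N%:R) <= 1 / 3).

Let cost p := N%:R * (`|s| * (2 * q p ^+ 2 * b p / N%:R ^+ 2) +
  s ^+ 2 * (2 * q p * b p / N%:R) ^+ 2).

Let E h := Rintegral P setT h.

Let bQf p : (p <= n)%N -> bdm (Q p n f).
Proof. exact: bdm_Qpn. Qed.

Let bQ1 p : (p <= n)%N -> bdm (Q p n (fun=> 1)).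
Proof. exact: bdm_Qpn1. Qed.

Let Q1_gt0 p : (p <= n)%N -> forall x, 0 < Q p n (fun=> 1) x.
Proof. exact: Qpn1_gt0. Qed.

Let Q_osc p : (p <= n)%N -> forall x y,
  `|Q p n f x * Q p n (fun=> 1) y - Q p n f y * Q p n (fun=> 1) x| <=
  b p * (Q p n (fun=> 1) x * Q p n (fun=> 1) y).
Proof.
move=> pn x y; have := bP _ pn x y; have x0 := Q1_gt0 _ pn x.
have y0 := Q1_gt0 _ pn y; rewrite /Defs.Ppn => h.
rewrite (_ : _ - _ = (Q p n f x / Q p n (fun=> 1) x -
    Q p n f y / Q p n (fun=> 1) y) * (Q p n (fun=> 1) x * Q p n (fun=> 1) y)).
  by rewrite normrM [`|_ * Q _ _ _ y|]gtr0_norm ?mulr_gt0// ler_wpM2r// mulr_ge0// ltW.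
by field; rewrite !gt_eqF.
Qed.

Let ratio p w := (\sum_i Q p n f (X p i w)) / (\sum_i Q p n (fun=> 1) (X p i w)).

Lemma laplace_initial :
  E (fun w => expR (s * ratio 0 w)) <=
  expR (cost 0) * expR (s * etaFK eta0 M G f).
Proof.
have [mX law0 _] := PX; have [x0] := probability_inhabited _ (probability_setT eta0).
have mean0 := Rintegral_mean eta0 (probability_setT eta0).
have := @laplace_step R _ _ Omega (S 0) N P (X 0)
  (fun _ _ h => Rintegral eta0 setT h) N0 (mX 0) (fun _ _ => mean0)
  (fun _ h _ => measurable_cst _) _ x0 (Q 0 n f) (Q 0 n (fun=> 1)) s (q 0) (b 0)
  (bQf _ (leq0n n)) (bQ1 _ (leq0n n)) (Q1_gt0 _ (leq0n n)) (qP _ (leq0n n))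
  (b0 _ (leq0n n)) (Q_osc _ (leq0n n)) (sP _ (leq0n n)).
move=> /(_ _)/le_trans; apply.
  move=> B mB; rewrite law0// integral_cst// -[LHS]mule1.
  congr (_ * _)%E; last exact/esym/probability_setT.
  by congr (_%:E); apply: eq_bigr => i _; rewrite Rintegral_indic.
rewrite ler_wpM2l ?expR_ge0// (mean_cst _ (Rintegral_mean P (probability_setT P))).
rewrite ler_expR !sumr_const card_ord -[X in X / _]mulr_natl -[X in _ / X]mulr_natl.
rewrite -mulf_div divff ?pnatr_eq0 -?lt0n// mul1r.
by have /= -> := @etaFK_ratio _ _ _ M G bG G0 eta0 0 n f bf (leq0n n).
Qed.

Lemma laplace_transition p : (p < n)%N ->
  E (fun w => expR (s * ratio p.+1 w)) <=
  expR (cost p.+1) * E (fun w => expR (s * ratio p w)).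
Proof.
move=> pn; have [mX _ lawS] := PX.
have [w0] := probability_inhabited _ (probability_setT P).
pose g w j := G p (X p j w); pose L w j := fun h => Mint M (X p j w) h.
have mL w i : is_mean (select_mean (g w) (L w) i).
  by apply: select_meanP => j; [exact: G01 | exact: Mint_mean].
have [lo lo0 loG] := G0 p.
have NR0 : 0 < N%:R :> R by rewrite ltr0n.
have sumlo w : N%:R * lo <= \sum_j g w j.
  rewrite -[N in N%:R]card_ord -sum1_card natr_sum mulr_suml.
  by apply: ler_sum => i _; rewrite mul1r; exact: loG.
have sg w : 0 < \sum_j g w j by rewrite (lt_le_trans _ (sumlo w))// mulr_gt0.
have bg i : bdm (fun w => g w i) by exact: (bdm_comp (X p i)).
have bLh i h : bdm h -> bdm (fun w => L w i h).
  by move=> bh; apply: (bdm_comp (X p i) (fun x => Mint M x h)) => //; exact: bdm_Mint.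
have bsel i h : bdm h -> bdm (fun w => select_mean (g w) (L w) i h).
  move=> bh; rewrite /select_mean; apply: bdmD; first exact/bdmM/bLh/bh/bg.
  apply: bdmM; first exact/bdmB/bg/bdm_cst.
  apply: bdmM; first by apply: bdm_sum => j; exact/bdmM/bLh/bh/bg.
  by apply: (bdmV (N%:R * lo)); [exact: bdm_sum | rewrite mulr_gt0 |].
have := @laplace_step R _ _ Omega (S p.+1) N P (X p.+1)
  (fun w => select_mean (g w) (L w)) N0 (mX p.+1) mL
  (fun i h bh => (bsel i h bh).1) _ (X p.+1 (Ordinal N0) w0)
  (Q p.+1 n f) (Q p.+1 n (fun=> 1)) s (q p.+1) (b p.+1)
  (bQf _ pn) (bQ1 _ pn) (Q1_gt0 _ pn) (qP _ pn) (b0 _ pn) (Q_osc _ pn) (sP _ pn).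
move=> /(_ _)/le_trans; apply.
  (* With no constraint on generation [p], the rectangle identity says that generation [p.+1] is a
     mixture of products of the laws [select_mean]. *)
  move=> B mB; have := lawS p (fun=> setT) B (fun=> measurableT) mB.
  rewrite [X in P X = _ -> _](_ : _ =
    \bigcap_(i in setT) [set w | B i (X p.+1 i w)]); last first.
    by apply/seteqP; split => w h i _; have := h i I => //= -[].
  move=> ->; apply: eq_integral => w _; congr (_%:E); apply: eq_bigr => i _.
  rewrite indicT mul1r /Kemp /select_mean /L /Defs.Mint Rintegral_indic//.
  by under [in RHS]eq_bigr do rewrite Rintegral_indic//.
rewrite ler_wpM2l ?expR_ge0// le_eqVlt; apply/orP; left; apply/eqP.
(* The factor [N] and the sum of potentials cancel in the quotient, and [Qpn_step] recognises the
   ratio at time [p]. *)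
congr E; apply/funext => w; rewrite !sum_select_mean//; congr (expR (s * _)).
rewrite -mulf_div divff ?pnatr_eq0 -?lt0n// mul1r -mulf_div divff; last first.
  by rewrite invr_eq0 gt_eqF.
by rewrite mulr1 /ratio !(Qpn_step M G p n).
Qed.

Lemma laplace_empirical :
  E (fun w => expR (s * (empir (fun i => X n i w) f - etaFK eta0 M G f))) <=
  expR (\sum_(0 <= p < n.+1) cost p).
Proof.
have mE := Rintegral_mean P (probability_setT P).
have H p : (p <= n)%N -> E (fun w => expR (s * ratio p w)) <=
    expR (\sum_(0 <= j < p.+1) cost j) * expR (s * etaFK eta0 M G f).
  elim: p => [_|p ih pn]; first by rewrite big_nat1; exact: laplace_initial.
  apply: (le_trans (laplace_transition _ pn)).
  rewrite big_nat_recr//= addrC expRD -mulrA ler_wpM2l ?expR_ge0//.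
  exact/ih/ltnW.
have := H n (leqnn n); rewrite -ler_pdivrMr ?expR_gt0// -expRN; apply: le_trans.
rewrite mulrC -(meanZ _ mE); last first.
  apply: bdm_expR; apply: bdmZ; rewrite /ratio Qpn_id; apply: bdmM.
    by apply: bdm_sum => i; apply: (bdm_comp (X n i)) => //; case: PX.
  by rewrite Qpn_id; exact: bdm_cst.
rewrite le_eqVlt; apply/orP; left; apply/eqP; congr E; apply/funext => w.
(* At [p = n] the denominator is a sum of [N] ones, so the ratio is the empirical mean. *)
rewrite -expRD /ratio !Qpn_id sumr_const card_ord /empir; congr expR.
by rewrite mulrBr addrC -[1 *+ N]/(N%:R) [_^-1 * _]mulrC.
Qed.

End Particles.

(** * Concentration of the empirical measures *)

Lemma mean_osc {R : realType} {d} {T : measurableType d}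
    (L L' : (T -> R) -> R) (h : T -> R) (c : R) :
  is_mean L -> is_mean L' -> bdm h -> (forall x y, `|h x - h y| <= c) ->
  `|L h - L' h| <= c.
Proof.
move=> mL mL' bh hc.
have le L1 L2 : is_mean L1 -> is_mean L2 -> L1 h - L2 h <= c.
  move=> m1 m2; rewrite lerBlDr -lerBlDl; apply: (mean_ge _ m2) => // y.
  rewrite lerBlDl; apply: (mean_le_cst _ m1) => // x.
  by rewrite -lerBlDr (le_trans (ler_norm _)).
by rewrite ler_norml lerNl opprB !le.
Qed.

Lemma Osc1_bdm {R : realType} {d} {T : measurableType d} (f : T -> R) :
  inhabited T -> Osc1 f -> bdm f.
Proof.
move=> [x0] [mf fO]; split => //; exists (1 + `|f x0|) => x.
by rewrite -[f x](subrK (f x0)) (le_trans (ler_normD _ _))// lerD2r.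
Qed.

Lemma measurable_norm_ge {R : realType} {d} {T : measurableType d} (D : T -> R)
    (e : R) : measurable_fun setT D -> measurable [set w | e <= `|D w|].
Proof.
move=> mD; have mN : measurable_fun setT (fun w => `|D w|).
  exact: measurableT_comp.
rewrite (_ : [set w | _] = (fun w => `|D w|) @^-1` `[e, +oo[).
  by rewrite -[X in measurable X]setTI; exact: mN.
by apply/seteqP; split => w /=; rewrite in_itv/= andbT.
Qed.

Lemma bdm_empir {R : realType} {d : nat -> measure_display}
    {S : forall n, measurableType (d n)} {dO} {Omega : measurableType dO} {N n}
    (Y : 'I_N -> Omega -> S n) (f : S n -> R) :
  (forall i, measurable_fun setT (Y i)) -> bdm f ->
  bdm (fun w => empir (Y^~ w) f).
Proof.
move=> mY bf; apply: bdmZ; apply: bdm_sum => i.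
exact: (bdm_comp (Y i)).
Qed.

Section FeynmanKacBounds.
Context {R : realType} {d : nat -> measure_display}
  {S : forall n, measurableType (d n)}.
Variables (M : forall n, R.-pker S n ~> S n.+1) (G : forall n, S n -> R).
Hypotheses (bG : forall n, bdm (G n)) (G0 : forall n, bounded_below (G n))
  (inhS : forall n, inhabited (S n)).
Local Notation Q := (@Defs.Qpn R d S M G).
Local Notation qpn := (@Defs.qpn R d S M G).
Local Notation beta := (@Defs.beta R d S M G).
Local Notation Ppn := (@Defs.Ppn R d S M G).

(** A real supremum bounds its set only once the set is known to be bounded; an upper bound on
    [Q p n (fun=> 1)] divided by a positive lower bound serves here. *)
Lemma qpn_sup p n : (p <= n)%N -> forall x y,
  Q p n (fun=> 1) x <= qpn p n * Q p n (fun=> 1) y.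
Proof.
move=> pn x y; have Q0 := Qpn1_gt0 _ _ bG G0 _ _ pn.
rewrite -ler_pdivrMr//; apply: ub_le_sup; last by exists x, y.
have [lo lo0 loQ] := Qpn_bounded_below M _ _ _ bG G0 pn.
have [_ [c hc]] := bdm_Qpn1 M _ bG _ _ pn.
exists (c / lo) => _ [u [v ->]].
have Qc : Q p n (fun=> 1) u <= c by exact: le_trans (ler_norm _) (hc u).
by apply: ler_pM => //; [exact: ltW | rewrite invr_ge0 ltW | rewrite lef_pV2 ?posrE].
Qed.

Lemma qpn_ge1 p n : (p <= n)%N -> 1 <= qpn p n.
Proof.
move=> pn; have [x] := inhS p.
by have := qpn_sup _ _ pn x x; rewrite -ler_pdivrMr ?divff ?gt_eqF// Qpn1_gt0.
Qed.

Lemma qpn_le p n c : (forall x y, Q p n (fun=> 1) x <= c * Q p n (fun=> 1) y) ->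
  (p <= n)%N -> qpn p n <= c.
Proof.
move=> h pn; have Q0 := Qpn1_gt0 _ _ bG G0 _ _ pn.
have [x] := inhS p; apply: ge_sup.
  by exists (Q p n (fun=> 1) x / Q p n (fun=> 1) x), x, x.
by move=> _ [u [v ->]]; rewrite ler_pdivrMr.
Qed.

Lemma beta_sup p n f : (p <= n)%N -> Osc1 f -> forall x y,
  `|Ppn p n f x - Ppn p n f y| <= beta p n.
Proof.
move=> pn fO x y; apply: ub_le_sup; last by exists f, x, y.
(* [Ppn] is a Markov operator, so 1 bounds the set and its supremum is meaningful. *)
exists 1 => _ [g [u [v [og ->]]]].
apply: (mean_osc (fun h => Ppn p n h u) (fun h => Ppn p n h v)).
- exact: Ppn_mean.
- exact: Ppn_mean.
- exact: Osc1_bdm.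
- by case: og.
Qed.

Lemma Osc1_cst n : Osc1 (fun _ : S n => 0 : R).
Proof. by split => // x y; rewrite subrr normr0. Qed.

Lemma beta_le p n c : (forall f x y, Osc1 f ->
  `|Ppn p n f x - Ppn p n f y| <= c) -> beta p n <= c.
Proof.
move=> h; have [x] := inhS p; apply: ge_sup.
  by exists `|Ppn p n (fun=> 0) x - Ppn p n (fun=> 0) x|, (fun=> 0), x, x;
    split => //; exact: Osc1_cst.
by move=> _ [f [u [v [fO ->]]]]; exact: h.
Qed.

Lemma beta_le1 p n : (p <= n)%N -> beta p n <= 1.
Proof.
move=> pn; apply: beta_le => f x y fO.
apply: (mean_osc (fun h => Ppn p n h x) (fun h => Ppn p n h y)).
- exact: Ppn_mean.
- exact: Ppn_mean.
- exact: Osc1_bdm.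
- by case: fO.
Qed.

Lemma beta_ge0 p n : (p <= n)%N -> 0 <= beta p n.
Proof.
move=> pn; have [x] := inhS p.
exact: le_trans (beta_sup _ _ _ pn (Osc1_cst n) x x).
Qed.

(** Chernoff's bound for both signs of [s]; the one sum bounded by [T] controls the quadratic term
    and the bias together. *)
Lemma concentration (eta0 : probability (S 0) R) (N : nat) dO
    (Omega : measurableType dO) (P : probability Omega R)
    (X : forall n, 'I_N -> Omega -> S n) (n : nat) (f : S n -> R) (T eps : R) :
  (forall n x, 0 < G n x < 1) -> (0 < N)%N -> particle_system eta0 M G P X ->
  Osc1 f -> 0 <= eps <= 1 -> 0 < T ->
  \sum_(0 <= p < n.+1) qpn p n ^+ 2 * beta p n <= T ->
  (P [set w | (eps <= `|empir (fun i => X n i w) f - etaFK eta0 M G f|)%R]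
   <= (6 * expR (- (N%:R * eps ^+ 2) / (16 * T)))%:E)%E.
Proof.
move=> G01 N0 PX fO /andP[eps0 eps1] T0 qbT.
have bf := Osc1_bdm _ (inhS n) fO.
have NR0 : 0 < N%:R :> R by rewrite ltr0n.
have qb_T p : (p <= n)%N -> qpn p n ^+ 2 * beta p n <= T.
  move=> pn; apply: le_trans qbT.
  rewrite big_mkord (bigD1 (inord p : 'I_n.+1))//= inordK ?ltnS// lerDl.
  apply: sumr_ge0 => i _; rewrite mulr_ge0 ?sqr_ge0// beta_ge0//.
  by rewrite -ltnS.
(* Minimiser of [4 * s ^+ 2 * T / N - s * eps], the exponent without the bias; the bias then
   contributes [eps / 4]. *)
pose s0 := N%:R * eps / (8 * T).
have s00 : 0 <= s0 by rewrite divr_ge0 ?mulr_ge0// ltW.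
pose D w := empir (fun i => X n i w) f - etaFK eta0 M G f.
pose E h := Rintegral P setT h.
have laplace s : `|s| = s0 ->
    E (fun w => expR (s * D w)) <=
    expR (eps / 4 + N%:R * eps ^+ 2 / (16 * T)).
  move=> ss; apply: (le_trans (laplace_empirical eta0 M G G01 bG G0 N dO Omega
    P X N0 PX n f (fun p => qpn p n) (fun p => beta p n) s bf _ _ _ _)).
  - by move=> p pn; exact: qpn_sup.
  - by move=> p pn; exact: beta_ge0.
  - by move=> p pn x y; exact: beta_sup.
  - move=> p pn; rewrite ss /s0.
    have q1 := qpn_ge1 _ _ pn; have b0 := beta_ge0 _ _ pn; have qbp := qb_T _ pn.
    have -> : N%:R * eps / (8 * T) * (2 * qpn p n * beta p n / N%:R) =
        eps * (qpn p n * beta p n) / (4 * T) by field; rewrite !gt_eqF.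
    rewrite ler_pdivrMr ?mulr_gt0//.
    have qb : qpn p n * beta p n <= T.
      by apply: le_trans qbp; rewrite ler_wpM2r// ler_eXnr.
    have : eps * (qpn p n * beta p n) <= 1 * T.
      by rewrite ler_pM// mulr_ge0// (le_trans ler01).
    by lra.
  rewrite ler_expR.
  have -> : eps / 4 + N%:R * eps ^+ 2 / (16 * T) =
      (2 * s0 / N%:R + 4 * s0 ^+ 2 / N%:R) * T.
    by rewrite /s0; field; rewrite !gt_eqF.
  apply: le_trans (ler_wpM2l _ qbT); last first.
    by apply: addr_ge0; rewrite divr_ge0 ?ler0n// mulr_ge0// sqr_ge0.
  rewrite mulr_sumr !big_mkord; apply: ler_sum => -[p /= pn] _.
  have b0 := beta_ge0 p n pn; have b1 := beta_le1 p n pn.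
  have s2 : s ^+ 2 = s0 ^+ 2 by rewrite -ss real_normK// num_real.
  rewrite ss s2.
  have -> : N%:R * (s0 * (2 * qpn p n ^+ 2 * beta p n / N%:R ^+ 2) +
      s0 ^+ 2 * (2 * qpn p n * beta p n / N%:R) ^+ 2) =
      2 * s0 / N%:R * (qpn p n ^+ 2 * beta p n) +
      4 * s0 ^+ 2 / N%:R * (qpn p n ^+ 2 * (beta p n * beta p n)).
    by field; rewrite !gt_eqF.
  (* The quadratic term carries [beta] squared, which is at most [beta] since [beta <= 1]. *)
  rewrite [leRHS]mulrDl lerD2l ler_wpM2l//.
    by rewrite divr_ge0 ?ler0n// mulr_ge0// sqr_ge0.
  apply: ler_wpM2l; [exact: sqr_ge0 | exact: (ler_piMr b0 b1)].
have bD : bdm D.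
  by apply: bdmB; [apply: bdm_empir => //; case: PX | exact: bdm_cst].
have mA := measurable_norm_ge D eps bD.1.
have mE : is_mean E := Rintegral_mean P (probability_setT P).
have bexp s : bdm (fun w => expR (s * D w)) by apply: bdm_expR; exact: bdmZ.
have key : expR (s0 * eps) * fine (P [set w | eps <= `|D w|]) <=
    2 * expR (eps / 4 + N%:R * eps ^+ 2 / (16 * T)).
  rewrite -Rintegral_indic// -/(E _) -(meanZ _ mE); last exact: bdm_indic.
  have e2 : E (fun w => expR (s0 * D w) + expR (- s0 * D w)) <=
      2 * expR (eps / 4 + N%:R * eps ^+ 2 / (16 * T)).
    rewrite (meanD _ mE)// mulrDl mul1r lerD// laplace// ?normrN ger0_norm//.
  apply: le_trans e2; apply: (mean_le _ mE).
  - by apply: bdmZ; exact: bdm_indic.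
  - exact: bdmD.
  move=> w; rewrite indicE; case: (boolP (w \in _)) => [|_]; last first.
    by rewrite mulr0 addr_ge0// expR_ge0.
  rewrite inE/= mulr1 => epsD.
  have [D0|D0] := leP 0 (D w).
    rewrite ger0_norm// in epsD; rewrite -[leLHS]addr0 lerD ?expR_ge0//.
    by rewrite ler_expR ler_wpM2l.
  rewrite ltr0_norm// in epsD; rewrite -[leLHS]add0r lerD ?expR_ge0//.
  by rewrite ler_expR mulNr -mulrN ler_wpM2l.
rewrite -[leLHS]fineK; last exact: fin_num_measure.
rewrite lee_fin; move: key; rewrite -ler_pdivlMl ?expR_gt0// -expRN => /le_trans.
apply; rewrite mulrCA -expRD.
have -> : - (s0 * eps) + (eps / 4 + N%:R * eps ^+ 2 / (16 * T)) =
    eps / 4 + - (N%:R * eps ^+ 2) / (16 * T).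
  by rewrite /s0; field; rewrite !gt_eqF.
rewrite expRD mulrA ler_wpM2r ?expR_ge0//.
(* [2 * expR (eps / 4)] is at most [2 * (1 + 1/4 + 1/16)], below the prefactor 6. *)
have e4 : expR (eps / 4) <= 1 + eps / 4 + (eps / 4) ^+ 2.
  by apply: expR_le_quadratic; lra.
have : eps ^+ 2 <= 1 by rewrite expr_le1.
rewrite expr_div_n in e4; lra.
Qed.

End FeynmanKacBounds.

(** * Comparison of two independent chains over a window of times *)

Section Window.
Context {R : realType} {d : nat -> measure_display}
  {S : forall n, measurableType (d n)}.
Variables (M : forall n, R.-pker S n ~> S n.+1) (G : forall n, S n -> R).
Hypotheses (bG : forall n, bdm (G n)) (G0 : forall n, bounded_below (G n)).
Local Notation Q := (@Defs.Qpn R d S M).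
Local Notation W := (@Defs.Wexc R d S M G).

Let Gpos n x : 0 < G n x. Proof. exact: bounded_below_gt0. Qed.

(** Measurability is joint in the running factor and the two starting points because one step of the
    recursion changes all three. *)
Lemma bdm_Wexc r len p :
  bdm (fun z : R * (S p * S p) => W r len p z.1 z.2.1 z.2.2).
Proof.
elim: len p => [|len ih] p /=.
  rewrite (_ : (fun _ => _) =
      \1_([set z : R * (S p * S p) | r < z.1]) :> (R * (S p * S p) -> R)).
    apply: bdm_indic; rewrite (_ : [set _ | _] = fst @^-1` `]r, +oo[).
      by rewrite -[X in measurable X]setTI; exact: measurable_fst.
    by apply/seteqP; split => z /=; rewrite in_itv/= andbT.
  apply/funext => z; rewrite indicE; case: ifPn => rz.
    by rewrite mem_set.
  by rewrite memNset//= => rz'; rewrite rz' in rz.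
pose Z := (R * (S p * S p))%type.
have mG j := (bG j).1.
have mfst : measurable_fun setT (fun z : Z => z.2.1).
  exact: (measurableT_comp measurable_fst measurable_snd).
have msnd : measurable_fun setT (fun z : Z => z.2.2).
  exact: (measurableT_comp measurable_snd measurable_snd).
have mratio : measurable_fun setT (fun z : Z => z.1 * (G p z.2.1 / G p z.2.2)).
  apply: measurable_funM; first exact: measurable_fst.
  apply: measurable_funM; first exact: (measurableT_comp (mG p) mfst).
  apply: measurable_fun_inv_pos; last by move=> z.
  exact: (measurableT_comp (mG p) msnd).
pose h (u : (Z * S p.+1) * S p.+1) : R * (S p.+1 * S p.+1) :=
  (u.1.1.1 * (G p u.1.1.2.1 / G p u.1.1.2.2), (u.1.2, u.2)).
have mh : measurable_fun setT h.
  apply: measurable_fun_pair.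
    apply: (measurableT_comp mratio).
    exact: (measurableT_comp measurable_fst measurable_fst).
  apply: measurable_fun_pair; last exact: measurable_snd.
  exact: (measurableT_comp measurable_snd measurable_fst).
have msnd1 : measurable_fun setT (fun u : Z * S p.+1 => u.1.2.2).
  exact: (measurableT_comp msnd measurable_fst).
have b1 := bdm_kernel_integral (M p) _ msnd1 _ (bdm_comp h _ mh (ih p.+1)).
exact: (bdm_kernel_integral (M p) _ mfst _ b1).
Qed.

Lemma bdm_Wexc_section r len p a (x : S p) : bdm (fun y => W r len p a x y).
Proof.
apply: (bdm_comp (fun y : S p => (a, (x, y))) _ _ (bdm_Wexc r len p)).
by do 2 (apply: measurable_fun_pair; first exact: measurable_cst);
  exact: measurable_id.
Qed.

Lemma bdm_Mint_Wexc r len p a (y : S p) :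
  bdm (fun x' => Mint M y (fun y' => W r len p.+1 a x' y')).
Proof.
apply: (bdm_kernel_integral (M p) (fun=> y) (measurable_cst _)
  (fun z => W r len p.+1 a z.1 z.2)).
apply: (bdm_comp (fun z : S p.+1 * S p.+1 => (a, z)) _ _ (bdm_Wexc r len p.+1)).
by apply: measurable_fun_pair; [exact: measurable_cst | exact: measurable_id].
Qed.

Lemma Wexc_ge0 r len p a (x y : S p) : 0 <= W r len p a x y.
Proof.
elim: len p a x y => [|len ih] p a x y /=; first by case: ifP.
apply: (mean_ge0 _ (Mint_mean M x)); first exact: bdm_Mint_Wexc.
move=> x'; apply: (mean_ge0 _ (Mint_mean M y)) => //.
exact: bdm_Wexc_section.
Qed.

(** Two-sided bounds on the potentials give a deterministic bound on the product of ratios, so the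
    set whose infimum is [rkl] is nonempty. *)
Lemma Wexc_eq0 len p : exists2 c, 0 < c &
  forall r a (x y : S p), 0 < a -> a * c <= r -> W r len p a x y = 0.
Proof.
elim: len p => [|len ih] p.
  exists 1 => // r a x y a0; rewrite mulr1 /= => ar.
  by rewrite ltNge ar.
have [c c0 hc] := ih p.+1; have [lo lo0 hlo] := G0 p; have [_ [C hC]] := bG p.
have [Cn|Cp] := leP C 0.
  exists 1 => // r a x y; have := Gpos p x; have := hC x.
  rewrite gtr0_norm// => h1 h2.
  by have := lt_le_trans h2 (le_trans h1 Cn); rewrite ltxx.
exists (C / lo * c); first by rewrite mulr_gt0// divr_gt0.
move=> r a x y a0 har /=.
have W0 x' y' : W r len p.+1 (a * (G p x / G p y)) x' y' = 0.
  apply: hc; first by rewrite mulr_gt0// divr_gt0.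
  apply: le_trans har; rewrite -mulrA ler_pM2l// ler_pM2r//.
  apply: ler_pM; [exact: ltW | by rewrite invr_ge0 ltW | |].
    by rewrite (le_trans (ler_norm _)).
  by rewrite lef_pV2 ?posrE.
rewrite [X in Mint M x X](_ : _ = fun=> 0) ?(mean_cst _ (Mint_mean M x))//.
apply/funext => x'.
rewrite [X in Mint M y X](_ : _ = fun=> 0) ?(mean_cst _ (Mint_mean M y))//.
exact/funext.
Qed.

(* [Wexc] bounds the defect of the inequality that holds when the ratio of the
   two path products never exceeds [r]; the potentials [u] and [w] reweight the
   two independent chains. *)
Lemma window_error (u w : forall n, S n -> R) r len p e (phi psi : S e -> R) :
  0 <= r -> (p + len = e)%N ->
  (forall j, bdm (u j)) -> (forall j x, 0 <= u j x) ->
  (forall j, bdm (w j)) -> (forall j x, 0 <= w j x) ->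
  bdm phi -> bdm psi -> (forall x, 0 <= phi x) -> (forall x, 0 <= psi x) ->
  exists2 K, 0 <= K & forall a (x y : S p), 0 < a ->
    a * (Q (fun j x => G j x * u j x) p e phi x * Q w p e psi y) <=
    r * (Q u p e phi x * Q (fun j x => G j x * w j x) p e psi y) +
    a * K * W r len p a x y.
Proof.
move=> r0 + bu u0 bw w0 bphi bpsi phi0 psi0.
have bGu j : bdm (fun x => G j x * u j x) by exact: bdmM.
have bGw j : bdm (fun x => G j x * w j x) by exact: bdmM.
elim: len p => [|len ih] p; rewrite ?addn0 => pe.
  subst e; have [_ [C hC]] := bphi; have [_ [C' hC']] := bpsi.
  (* For [a <= r] the inequality holds outright; for [r < a], [Wexc] is 1 and the bound on
     [phi x * psi y] absorbs the left side. *)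
  exists `|C * C'| => // a x y a0; rewrite !Qpn_id /=.
  have P0 : 0 <= phi x * psi y by rewrite mulr_ge0.
  have PC : phi x * psi y <= `|C * C'|.
    rewrite (le_trans _ (ler_norm _))// ler_pM//.
      by rewrite (le_trans (ler_norm _)).
    by rewrite (le_trans (ler_norm _)).
  case: ltP => ra; last by rewrite mulr0 addr0 ler_wpM2r.
  by rewrite mulr1 ler_wpDl ?mulr_ge0// ler_wpM2l// ltW.
have pe' : (p < e)%N by rewrite -pe addnS ltnS leq_addr.
have [K K0 hK] := ih p.+1 (etrans (esym (addnS _ _)) pe).
have [_ [Cu hCu]] := bu p; have [_ [Cw hCw]] := bw p; have [_ [CG hCG]] := bG p.
exists (K * `|CG * Cu * Cw|); first by rewrite mulr_ge0.
move=> a x y a0; rewrite !(Qpn_step _ _ p e)//=.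
have mx := Mint_mean M x; have my := Mint_mean M y.
set f1 := Q _ p.+1 e phi; set f2 := Q w p.+1 e psi.
set f3 := Q u p.+1 e phi; set f4 := Q _ p.+1 e psi.
have b1 : bdm f1 by exact: bdm_Qpn.
have b2 : bdm f2 by exact: bdm_Qpn.
have b3 : bdm f3 by exact: bdm_Qpn.
have b4 : bdm f4 by exact: bdm_Qpn.
pose a' := a * (G p x / G p y).
have a'0 : 0 < a' by rewrite mulr_gt0// divr_gt0.
have step1 x' : a' * (f1 x' * Mint M y f2) <= r * (f3 x' * Mint M y f4) +
    a' * K * Mint M y (fun y' => W r len p.+1 a' x' y').
  have bW := bdm_Wexc_section r len p.+1 a' x'.
  have -> : a' * (f1 x' * Mint M y f2) = Mint M y (fun y' => a' * f1 x' * f2 y').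
    by rewrite (meanZ _ my)// mulrA.
  have -> : r * (f3 x' * Mint M y f4) +
      a' * K * Mint M y (fun y' => W r len p.+1 a' x' y') =
      Mint M y (fun y' => r * f3 x' * f4 y' + a' * K * W r len p.+1 a' x' y').
    rewrite (meanD _ my); [|exact: bdmZ..].
    by rewrite !(meanZ _ my)// mulrA.
  apply: (mean_le _ my); [exact: bdmZ | by apply: bdmD; exact: bdmZ |] => y'.
  by have := hK a' x' y' a'0; rewrite !mulrA.
have step2 : a' * (Mint M x f1 * Mint M y f2) <=
    r * (Mint M x f3 * Mint M y f4) + a' * K * W r len.+1 p a x y.
  rewrite /=; have bW := bdm_Mint_Wexc r len p a' y.
  have -> : a' * (Mint M x f1 * Mint M y f2) =
      Mint M x (fun x' => a' * Mint M y f2 * f1 x').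
    by rewrite (meanZ _ mx)//; ring.
  have -> : r * (Mint M x f3 * Mint M y f4) + a' * K *
      Mint M x (fun x' => Mint M y (fun y' => W r len p.+1 a' x' y')) =
      Mint M x (fun x' => r * Mint M y f4 * f3 x' +
        a' * K * Mint M y (fun y' => W r len p.+1 a' x' y')).
    rewrite (meanD _ mx); [|exact: bdmZ..].
    by rewrite !(meanZ _ mx)//; ring.
  apply: (mean_le _ mx); [exact: bdmZ | by apply: bdmD; exact: bdmZ |] => x'.
  by have := step1 x'; lra.
have Gy := Gpos p y; have Gx := Gpos p x.
(* This factor restores the potentials of time [p]: it turns [a'] into [a * G p x] on the left and
   gives [G p y] to the second chain on the right. *)
have c0 : 0 <= G p y * u p x * w p y by rewrite !mulr_ge0// ltW.
have := ler_wpM2l c0 step2.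
have -> : G p y * u p x * w p y * (a' * (Mint M x f1 * Mint M y f2)) =
    a * (G p x * u p x * Mint M x f1 * (w p y * Mint M y f2)).
  by rewrite /a'; field; rewrite gt_eqF.
move/le_trans; apply; rewrite mulrDr.
have -> : G p y * u p x * w p y * (r * (Mint M x f3 * Mint M y f4)) =
    r * (u p x * Mint M x f3 * (G p y * w p y * Mint M y f4)) by ring.
rewrite lerD2l.
have -> : G p y * u p x * w p y * (a' * K * W r len.+1 p a x y) =
    (a * K * W r len.+1 p a x y) * (G p x * u p x * w p y).
  by rewrite /a'; field; rewrite gt_eqF.
have -> : a * (K * `|CG * Cu * Cw|) *
    Mint M x (fun x' => Mint M y [eta W r len p.+1 (a * (G p x / G p y)) x']) =
    (a * K * W r len.+1 p a x y) * `|CG * Cu * Cw| by rewrite /=; ring.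
apply: ler_wpM2l; first by rewrite !mulr_ge0 ?Wexc_ge0// ltW.
have nle j (h : S j -> R) z c : (forall x, `|h x| <= c) -> 0 <= h z -> h z <= c.
  by move=> hc h0; rewrite (le_trans (ler_norm _)).
rewrite (le_trans _ (ler_norm _))// !ler_pM ?mulr_ge0// ?(ltW Gx)//.
- by apply: nle => //; exact: ltW.
- exact: nle.
- exact: nle.
Qed.

(** For [r] in the set defining [rkl] the error of [window_error] vanishes, and the inequality
    passes to the infimum. In effect [G] moves from the chain started at [x] to the one started at
    [y], at the price [rkl]. *)
Lemma window (u w : forall n, S n -> R) p e (phi psi : S e -> R) :
  (p <= e)%N ->
  (forall j, bdm (u j)) -> (forall j x, 0 <= u j x) ->
  (forall j, bdm (w j)) -> (forall j x, 0 <= w j x) ->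
  bdm phi -> bdm psi -> (forall x, 0 <= phi x) -> (forall x, 0 <= psi x) ->
  forall x y : S p,
    Q (fun j x => G j x * u j x) p e phi x * Q w p e psi y <=
    rkl M G p e * (Q u p e phi x * Q (fun j x => G j x * w j x) p e psi y).
Proof.
move=> pe bu u0 bw w0 bphi bpsi phi0 psi0 x y.
set A := [set r | 0 < r /\ forall x y : S p, W r (e - p) p 1 x y = 0].
have [c c0 hc] := Wexc_eq0 (e - p) p.
have Ac : A c by split => // x' y'; apply: hc => //; rewrite mul1r.
set F := _ * Q w p e psi y; set X := Q u p e phi x * _.
have FX r : A r -> F <= r * X.
  move=> [r0 rW]; have [K _ hK] := window_error u w r (e - p) p e phi psi
    (ltW r0) (subnKC pe) bu u0 bw w0 bphi bpsi phi0 psi0.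
  by have := hK 1 x y ltr01; rewrite rW mulr0 addr0 mul1r.
have X0 : 0 <= X.
  by apply: mulr_ge0; apply: Qpn_ge0 => // [j|j x']; [exact: bdmM |
    rewrite mulr_ge0// ltW].
(* Passing to the infimum divides by [X]; if [X = 0], the constant [c] already gives [F <= 0]. *)
move: X0; rewrite le_eqVlt => /predU1P[X0|X0].
  by rewrite -X0 mulr0; have := FX c Ac; rewrite -X0 mulr0.
rewrite -ler_pdivrMr//; apply: lb_le_inf; first by exists c.
by move=> r Ar; rewrite ler_pdivrMr//; exact: FX.
Qed.

End Window.

(** * Minorization and contraction of functionals *)

Lemma mean_minorization {R : realType} {d} {T : measurableType d}
    (L L' : (T -> R) -> R) (c : R) (h : T -> R) :
  is_mean L -> is_mean L' -> 0 <= c ->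
  (forall B, measurable B -> c * L' (\1_B) <= L (\1_B)) ->
  bdm h -> (forall x, 0 <= h x) -> c * L' h <= L h.
Proof.
move=> mL mL' c0 LB bh h0; apply/ler_addgt0Pr => e e0.
(* Rounding [h] to finitely many values reduces the claim to indicators; the error enters once
   through [L] and [c] times through [L'], hence [1 + c]. *)
have e'0 : 0 < e / (1 + c) by rewrite divr_gt0//; lra.
have [K [cell [mcell hcell]]] := bdm_cells h _ bh e'0.
have [[x0 _]|noT] := pselect (exists x : T, True); last first.
  suff -> : h = fun=> 0 by rewrite (mean_cst _ mL) (mean_cst _ mL') mulr0 add0r ltW.
  by apply/funext => x; exfalso; apply: noT; exists x.
pose z k := xget x0 (cell @^-1` [set k]).
have cellz x : cell (z (cell x)) = cell x.
  by rewrite /z; case: xgetP => [y _ /= ->|/(_ x) []].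
have b1 k : bdm (\1_(cell @^-1` [set k]) : T -> R) by exact: bdm_indic.
have hzE x : h (z (cell x)) = \sum_k h (z k) * \1_(cell @^-1` [set k]) x.
  rewrite (bigD1 (cell x))//= indicE mem_set// mulr1 big1 ?addr0// => k kn.
  by rewrite indicE memNset ?mulr0//= => kE; rewrite kE eqxx in kn.
pose k := fun x => \sum_k h (z k) * (\1_(cell @^-1` [set k]) : T -> R) x.
have bk : bdm k by apply: bdm_sum => i; exact: bdmZ.
have kh x : `|h x - k x| <= e / (1 + c).
  by rewrite /k -hzE; apply: hcell; rewrite cellz.
have mk L1 : is_mean L1 ->
    L1 k = \sum_k h (z k) * L1 (\1_(cell @^-1` [set k])).
  move=> mL1; rewrite /k (mean_sum _ mL1); last by move=> i; exact: bdmZ.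
  by apply: eq_bigr => i _; rewrite (meanZ _ mL1).
have lek : c * L' k <= L k.
  rewrite !mk// mulr_sumr; apply: ler_sum => i _.
  by rewrite mulrCA ler_wpM2l// LB.
have close L1 : is_mean L1 -> `|L1 h - L1 k| <= e / (1 + c).
  by move=> mL1; rewrite -(meanB _ mL1)//; apply: (mean_norm _ mL1) => //; exact: bdmB.
have /ler_normlP[_ h1] := close _ mL; have /ler_normlP[h2 _] := close _ mL.
have /ler_normlP[_ h3] := close _ mL'.
have h4 : c * L' h <= c * (L' k + e / (1 + c)) by rewrite ler_wpM2l//; lra.
have h5 : e / (1 + c) + c * (e / (1 + c)) = e by field; rewrite gt_eqF//; lra.
by lra.
Qed.

(** Dobrushin's argument: removing the common part [theta * nu] and rescaling by [1 - theta] leaves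
    two means, whose values at [h] differ by at most [c]. *)
Lemma mean_contraction {R : realType} {d} {T : measurableType d}
    (L1 L2 nu : (T -> R) -> R) (theta c : R) (h : T -> R) :
  is_mean L1 -> is_mean L2 -> is_mean nu -> theta < 1 ->
  (forall k, bdm k -> (forall x, 0 <= k x) -> theta * nu k <= L1 k) ->
  (forall k, bdm k -> (forall x, 0 <= k x) -> theta * nu k <= L2 k) ->
  bdm h -> (forall x y, `|h x - h y| <= c) ->
  `|L1 h - L2 h| <= (1 - theta) * c.
Proof.
move=> m1 m2 mn t1 le1 le2 bh hc.
have t0 : 0 < 1 - theta by rewrite subr_gt0.
have mres L : is_mean L ->
    (forall k, bdm k -> (forall x, 0 <= k x) -> theta * nu k <= L k) ->
    is_mean (fun k => (L k - theta * nu k) / (1 - theta)).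
  move=> mL le; split.
  - by rewrite (mean_cst _ mL) (mean_cst _ mn) mulr1 divff// gt_eqF.
  - move=> a f g bf bg; rewrite (mean_lin _ mL)// (mean_lin _ mn)//.
    by field; rewrite gt_eqF.
  - by move=> f bf f0; rewrite divr_ge0 ?(ltW t0)// subr_ge0 le.
have := mean_osc _ _ h c (mres _ m1 le1) (mres _ m2 le2) bh hc.
have -> : (L1 h - theta * nu h) / (1 - theta) - (L2 h - theta * nu h) / (1 - theta) =
    (L1 h - L2 h) / (1 - theta) by field; rewrite gt_eqF.
by rewrite normrM normfV (gtr0_norm t0) ler_pdivrMr// mulrC.
Qed.

(** * Bounds on [qpn] and [beta] under the mixing condition *)

Section Mixing.
Context {R : realType} {d : nat -> measure_display}
  {S : forall n, measurableType (d n)}.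
Variables (M : forall n, R.-pker S n ~> S n.+1) (G : forall n, S n -> R).
Hypotheses (bG : forall n, bdm (G n)) (G0 : forall n, bounded_below (G n))
  (inhS : forall n, inhabited (S n)).
Local Notation Q := (@Defs.Qpn R d S M).
Local Notation qpn := (@Defs.qpn R d S M G).
Local Notation beta := (@Defs.beta R d S M G).
Local Notation Ppn := (@Defs.Ppn R d S M G).
Local Notation one := (fun j (_ : S j) => 1 : R).
Local Notation rkl := (rkl M G).

Let bone j : bdm (one j). Proof. exact: bdm_cst. Qed.
Let one0 j x : 0 <= one j x. Proof. exact: ler01. Qed.
Let one_below j : bounded_below (one j). Proof. by exists 1. Qed.
Let Gone : (fun j (x : S j) => G j x * 1) = G.
Proof.
by apply: functional_extensionality_dep => j; apply/funext => x; rewrite mulr1.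
Qed.

Let Q1_gt0 p n : (p <= n)%N -> forall x, 0 < Q G p n (fun=> 1) x.
Proof. exact: Qpn1_gt0. Qed.
Let bQ1 p n : (p <= n)%N -> bdm (Q G p n (fun=> 1)).
Proof. exact: bdm_Qpn1. Qed.

Lemma Mpn_mean p n : (p <= n)%N ->
  forall x, is_mean (fun h => Q one p n h x).
Proof.
move=> pn x; have := Ppn_mean M one bone one_below p n pn x.
rewrite /Defs.Ppn; under eq_fun do rewrite (Qpn_const M p n (fun=> 1))// divr1.
by [].
Qed.

Lemma Qpn_local H H' p n (f : S n -> R) :
  (forall j x, (p <= j < n)%N -> H j x = H' j x) -> (p <= n)%N ->
  Q H p n f = Q H' p n f.
Proof.
move=> + pn; move: p pn; apply: Qpn_ind => [|p pn ih HH]; first by rewrite !Qpn_id.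
rewrite !(Qpn_step _ _ p n)// ih => [|j x /andP[pj jn]]; last first.
  by apply: HH; rewrite jn (ltnW pj).
by apply/funext => x; rewrite HH// leqnn.
Qed.

Lemma rkl_ge1 p e : (p <= e)%N -> 1 <= rkl p e.
Proof.
move=> pe; have [x] := inhS p.
have := window M G bG G0 one one p e (fun=> 1) (fun=> 1) pe bone one0 bone one0
  (bdm_cst 1) (bdm_cst 1) (fun=> ler01) (fun=> ler01) x x.
by rewrite Gone Qpn_const// mulr1 mul1r -ler_pdivrMr ?divff ?gt_eqF ?Q1_gt0.
Qed.

Variables (m : nat) (delta : nat -> R).
Hypotheses (m0 : (0 < m)%N) (cM : condM M m delta).

Let delta0 p : 0 < delta p. Proof. by case: cM => /(_ p)/andP[]. Qed.

Lemma condM_fun p (h : S (m + p) -> R) : bdm h -> (forall x, 0 <= h x) ->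
  forall x y, delta p * Q one p (m + p) h y <= Q one p (m + p) h x.
Proof.
move=> bh h0 x y; have pm : (p <= m + p)%N by rewrite leq_addl.
apply: (mean_minorization (fun h => Q one p (m + p) h x)
  (fun h => Q one p (m + p) h y)) => //.
- exact: Mpn_mean.
- exact: Mpn_mean.
- exact: ltW.
by move=> B mB; have [_ /(_ p x y B mB)] := cM; rewrite !Mf_Qpn.
Qed.

(** [window] exchanges the potentials of the two chains over the first [m] steps; the mutation
    averages of [g] left at time [m + p] are compared through [delta]. *)
Lemma qpn_long p n : (m + p <= n)%N -> qpn p n <= rkl p (p + m) / delta p.
Proof.
move=> pmn; have pm : (p <= m + p)%N by rewrite leq_addl.
have pn := leq_trans pm pmn.
apply: qpn_le => // x y; rewrite addnC.
pose g := Q G (m + p) n (fun=> 1).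
have bg : bdm g by exact: bQ1.
have g0 z : 0 <= g z by exact/ltW/Q1_gt0.
have := window M G bG G0 one one p _ g g pm bone one0 bone one0 bg bg g0 g0 x y.
rewrite Gone -!(Qpn_comp _ _ p _ n)//.
set mu := Q one p (m + p) g => h1.
have h2 : delta p * mu x <= mu y by exact: condM_fun.
have mu0 : 0 < mu x.
  have [lo lo0 hlo] := Qpn_bounded_below M G _ _ bG G0 pmn.
  by rewrite (lt_le_trans lo0)//; apply: (mean_ge _ (Mpn_mean _ _ pm x)).
have Qx := Q1_gt0 _ _ pn x.
rewrite mulrAC ler_pdivlMr ?delta0// -(ler_pM2r mu0).
apply: (@le_trans _ _ (Q G p n (fun=> 1) x * mu y)).
  by rewrite -mulrA ler_wpM2l// ltW.
by apply: (le_trans h1); rewrite le_eqVlt; apply/orP; left; apply/eqP; ring.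
Qed.

(** The minorization holds only at time [m + p], after [n], so the potentials between [n] and
    [m + p] must be undone. The endpoint [e] stays free: two choices of it are combined in
    [sum_qpn_beta]. *)
Lemma qpn_short p n e : (p < n)%N -> (n < m + p)%N -> (m + p <= e)%N ->
  qpn p n <= rkl p (p + m) * rkl n e / delta p.
Proof.
move=> pn' nm me; have pn := ltnW pn'; have nm' := ltnW nm.
have pm := leq_trans pn nm'; have ne := leq_trans nm' me.
apply: qpn_le => // x y; rewrite addnC.
(* With A, B, C the products of [G] over [[p,n)], [[n,m+p)], [[m+p,e)], [v] is
   1/B: E_x[A] E_y[C] <= r E_x[1/B] E_y[ABC] and E_x[1/B] E_y[ABC] <=
   r' E_x[C] E_y[A], while E_x[C] <= E_y[C] / delta. *)
pose v j (z : S j) : R := if (n <= j < m + p)%N then (G j z)^-1 else 1.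
have bv j : bdm (v j).
  rewrite /v; case: (n <= j < m + p)%N; last exact: bdm_cst.
  by have [lo lo0 hlo] := G0 j; exact: (bdmV lo).
have v0 j z : 0 <= v j z.
  by rewrite /v; case: ifP => // _; rewrite invr_ge0 ltW// bounded_below_gt0.
have Gv j z : (n <= j < m + p)%N -> G j z * v j z = 1.
  by move=> nj; rewrite /v nj divff// gt_eqF// bounded_below_gt0.
have Nv j z : ~~ (n <= j < m + p)%N -> v j z = 1.
  by rewrite /v => /negbTE ->.
pose Gv_ j (z : S j) := G j z * v j z.
pose C := Q G (m + p) e (fun=> 1); pose xi := Q v n (m + p) (fun=> 1).
pose zeta := Q G n e (fun=> 1); pose gam := Q one n (m + p) C.
have bC : bdm C by exact: bQ1.
have C0 z : 0 <= C z by exact/ltW/Q1_gt0.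
have one0' n' (z : S n') : 0 <= (1 : R) by [].
have h1 := window M G bG G0 v one p _ (fun=> 1) C pm bv v0 bone one0
  (bdm_cst 1) bC (one0' _) C0 x y.
have h2 z z' := window M G bG G0 one v n e (fun=> 1) (fun=> 1) ne bone one0 bv v0
  (bdm_cst 1) (bdm_cst 1) (one0' _) (one0' _) z z'.
have Gvn : Q Gv_ n (m + p) (fun=> 1) = fun=> 1.
  rewrite (Qpn_local Gv_ one _ _ _ Gv nm').
  by apply/funext => z; rewrite Qpn_const.
have outl j : (p <= j < n)%N -> ~~ (n <= j < m + p)%N.
  by move=> /andP[_ jn]; rewrite leqNgt jn.
have outr j : (m + p <= j < e)%N -> ~~ (n <= j < m + p)%N.
  by move=> /andP[mj _]; rewrite [(j < _)%N]ltnNge mj andbF.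
have E1 : Q Gv_ p (m + p) (fun=> 1) = Q G p n (fun=> 1).
  rewrite (Qpn_comp _ _ p n)// Gvn; apply: Qpn_local => // j z /outl nj.
  by rewrite /Gv_ Nv// mulr1.
have E2 : Q v p (m + p) (fun=> 1) = Q one p n xi.
  rewrite (Qpn_comp _ _ p n)//; apply: Qpn_local => // j z /outl nj.
  exact: Nv.
have E3 : Q G p (m + p) C = Q G p n zeta.
  rewrite /C -Qpn_comp// (Qpn_comp _ _ p n e)//.
have E4 : Q v n e (fun=> 1) = xi.
  rewrite (Qpn_comp _ _ n (m + p) e)//; congr (Q v n (m + p) _).
  rewrite (Qpn_local v one _ _ _ _ me); last by move=> j z /outr; exact: Nv.
  by apply/funext => z; rewrite Qpn_const.
have E5 : Q Gv_ n e (fun=> 1) = gam.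
  rewrite (Qpn_comp _ _ n (m + p) e)// (Qpn_local Gv_ one _ _ _ Gv nm').
  congr (Q one n (m + p) _); apply: Qpn_local => // j z /outr nj.
  by rewrite /Gv_ Nv// mulr1.
have E6 : Q one p n gam = Q one p (m + p) C by rewrite /gam -Qpn_comp.
rewrite Gone -/Gv_ E1 E2 E3 in h1.
have bxi : bdm xi by apply: bdm_Qpn => //; exact: bdm_cst.
have bzeta : bdm zeta by exact: bQ1.
have bgam : bdm gam by exact: bdm_Qpn.
have h3 z z' : xi z * zeta z' <= rkl n e * (gam z * 1).
  have := h2 z' z; rewrite Gone -/Gv_ E4 E5 Qpn_const// mul1r mulr1.
  by rewrite mulrC.
(* The chain from [y] is averaged under [Ppn], which sends 1 to 1 and supplies the denominator
   [Q G p n (fun=> 1) y] wanted in the conclusion. *)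
have h4 := ler_prod_mean (fun h => Q one p n h x) (fun h => Ppn p n h y)
  xi gam zeta (fun=> 1) (rkl n e) (Mpn_mean _ _ pn x)
  (Ppn_mean M G bG G0 _ _ pn y) bxi bzeta bgam (bdm_cst 1) h3.
have Qy := Q1_gt0 _ _ pn y; have Qx := Q1_gt0 _ _ pn x.
rewrite (mean_cst _ (Ppn_mean M G bG G0 _ _ pn y)) mulr1 E6 in h4.
rewrite /Defs.Ppn mulrA ler_pdivrMr// in h4.
set mu := Q one p (m + p) C in h1 h4.
have h5 : delta p * mu x <= mu y by exact: condM_fun.
have mu0 : 0 < mu x.
  have [lo lo0 hlo] := Qpn_bounded_below M G _ _ bG G0 me.
  by rewrite (lt_le_trans lo0)//; apply: (mean_ge _ (Mpn_mean _ _ pm x)).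
have r0 : 0 <= rkl p (m + p) by rewrite (le_trans ler01)// rkl_ge1.
rewrite mulrAC ler_pdivlMr ?delta0// -(ler_pM2r mu0).
apply: (@le_trans _ _ (Q G p n (fun=> 1) x * mu y)).
  by rewrite -mulrA ler_wpM2l// ltW.
apply: (le_trans h1); apply: (le_trans (ler_wpM2l r0 h4)).
by rewrite le_eqVlt; apply/orP; left; apply/eqP; ring.
Qed.

(** [Ppn p n] factors through a Markov operator to time [m + p] that dominates [theta] times a fixed
    law [nu]. The condition on [M] is used in the numerator and in the denominator, hence
    [delta p ^+ 2]. *)
Lemma Ppn_contraction p n (theta c : R) (f : S n -> R) :
  (m + p <= n)%N -> bdm f -> 0 <= theta < 1 ->
  theta * rkl p.+1 (p.+1 + m.-1) <= delta p ^+ 2 ->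
  (forall x y, `|Ppn (m + p) n f x - Ppn (m + p) n f y| <= c) ->
  forall x y, `|Ppn p n f x - Ppn p n f y| <= (1 - theta) * c.
Proof.
move=> pmn bf /andP[th0 th1] hth hc x y.
have pm : (p <= m + p)%N by rewrite leq_addl.
have pm' : (p.+1 <= m + p)%N by rewrite -add1n leq_add2r.
have pn := leq_trans pm pmn; have e0 := Q1_gt0 _ _ pmn.
pose g := Q G (m + p) n (fun=> 1).
have bg : bdm g by exact: bQ1.
pose L z h := Q G p (m + p) (fun u => g u * h u) z / Q G p n (fun=> 1) z.
have EL z : Ppn p n f z = L z (Ppn (m + p) n f).
  rewrite /L /Defs.Ppn; congr (_ / _); rewrite (Qpn_comp _ _ p (m + p) n)//.
  by congr (Q _ _ _ _ _); apply/funext => u; rewrite mulrC divfK// gt_eqF.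
pose nu h := Q one p (m + p) (fun u => g u * h u) x / Q one p (m + p) g x.
have Mg0 z : 0 < Q one p (m + p) g z.
  have [lo lo0 hlo] := Qpn_bounded_below M G _ _ bG G0 pmn.
  by rewrite (lt_le_trans lo0)//; apply: (mean_ge _ (Mpn_mean _ _ pm z)).
have gpos u : 0 < g u by exact: e0.
have bgh h : bdm h -> bdm (fun u => g u * h u) by exact: bdmM.
have gh0 h : (forall u, 0 <= h u) -> forall u, 0 <= g u * h u.
  by move=> h0 u; rewrite mulr_ge0// ltW.
have ghlin c' h k : (fun u => g u * (c' * h u + k u)) =
    fun u => c' * (g u * h u) + g u * k u.
  by apply/funext => u; ring.
have mL z : is_mean (L z).
  have Qz := Q1_gt0 _ _ pn z; split; rewrite /L.
  - under [X in Q _ _ _ X _]eq_fun do rewrite mulr1.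
    by rewrite /g -Qpn_comp// divff// gt_eqF.
  - move=> c' h k bh bk; rewrite ghlin Qpn_lin//; [|exact: bgh..].
    by rewrite mulrDl mulrA.
  - move=> h bh h0; rewrite divr_ge0 ?(ltW Qz)//.
    apply: Qpn_ge0 => //; [|exact: bgh | exact: gh0].
    by move=> j z'; exact/ltW/bounded_below_gt0.
have mnu : is_mean nu.
  have mM := Mpn_mean _ _ pm x; split; rewrite /nu.
  - under [X in Q _ _ _ X _ / _]eq_fun do rewrite mulr1.
    by rewrite divff// gt_eqF.
  - move=> c' h k bh bk; rewrite ghlin (mean_lin _ mM); [|exact: bgh..].
    by rewrite mulrDl mulrA.
  - move=> h bh h0; rewrite divr_ge0 ?(ltW (Mg0 _))// (mean_ge0 _ mM)//.
      exact: bgh.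
    exact: gh0.
have minor z h : bdm h -> (forall u, 0 <= h u) -> theta * nu h <= L z h.
  move=> bh h0; set gh := fun u => g u * h u.
  have bgh' : bdm gh by exact: bgh.
  have gh0' u : 0 <= gh u by exact: gh0.
  set r := rkl p.+1 (p.+1 + m.-1) in hth.
  have r1 : 1 <= r by apply: rkl_ge1; rewrite leq_addr.
  (* Both sides start from [z] at time [p], so the potential there is common and the window opens
     only at [p.+1]; hence a ratio over [m.-1] steps. *)
  have win x' y' : Q G p.+1 (m + p) g x' * Q one p.+1 (m + p) gh y' <=
      r * (Q one p.+1 (m + p) g x' * Q G p.+1 (m + p) gh y').
    have := window M G bG G0 one one p.+1 _ g gh pm' bone one0 bone one0 bg bgh'
      (fun u => ltW (gpos u)) gh0' x' y'.
    have rE : (p.+1 + m.-1 = m + p)%N by rewrite addSnnS prednK// addnC.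
    by rewrite Gone /r rE.
  have := ler_prod_mean _ _ _ _ _ _ _ (Mint_mean M z) (Mint_mean M z)
    (bdm_Qpn _ _ _ _ _ bG bg pm') (bdm_Qpn _ _ _ _ _ bone bgh' pm')
    (bdm_Qpn _ _ _ _ _ bone bg pm') (bdm_Qpn _ _ _ _ _ bG bgh' pm') win.
  have Gz := bounded_below_gt0 _ z (G0 p).
  rewrite -(ler_pM2l Gz) /=.
  have Eg : Q G p n (fun=> 1) z = G p z * Mint M z (Q G p.+1 (m + p) g).
    by rewrite (Qpn_comp _ _ p (m + p) n)// (Qpn_step _ _ p (m + p)).
  have Egh : Q G p (m + p) gh z = G p z * Mint M z (Q G p.+1 (m + p) gh).
    by rewrite (Qpn_step _ _ p (m + p)).
  have Eo k : Mint M z (Q one p.+1 (m + p) k) = Q one p (m + p) k z.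
    by rewrite (Qpn_step _ _ p (m + p))// mul1r.
  rewrite [G p z * (Mint _ _ _ * _)]mulrA -Eg !Eo.
  have -> : G p z * (r * (Q one p (m + p) g z *
      Mint M z (Q G p.+1 (m + p) gh))) =
      r * (Q one p (m + p) g z * Q G p (m + p) gh z) by rewrite Egh; ring.
  move=> h1.
  have h2 := condM_fun p gh bgh' gh0' z x.
  have h3 := condM_fun p g bg (fun u => ltW (gpos u)) x z.
  have Qz := Q1_gt0 _ _ pn z.
  rewrite /L -/gh ler_pdivlMr// /nu -/gh.
  set A := Q one p (m + p) gh x in h2 *; set B := Q one p (m + p) g x in h3 *.
  set A' := Q one p (m + p) gh z in h1 h2 *.
  set B' := Q one p (m + p) g z in h1 h3 *.
  set F := Q G p n (fun=> 1) z in h1 Qz *; set X := Q G p (m + p) gh z in h1 *.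
  have B0 : 0 < B := Mg0 x; have B'0 : 0 < B' := Mg0 z.
  have A0 : 0 <= A by apply: (mean_ge0 _ (Mpn_mean _ _ pm x)).
  have r0 : 0 < r by exact: lt_le_trans r1.
  have d0 := delta0 p.
  have -> : theta * (A / B) * F = (theta * A * F) / B by field; rewrite gt_eqF.
  rewrite ler_pdivrMr// -(ler_pM2l r0) -(ler_pM2l B'0).
  apply: (@le_trans _ _ (B' * (delta p ^+ 2 * (A * F)))).
    rewrite ler_pM2l//.
    have -> : r * (theta * A * F) = theta * r * (A * F) by ring.
    by rewrite ler_wpM2r// mulr_ge0// ltW.
  apply: (@le_trans _ _ (delta p * B' * (F * A'))).
    have -> : B' * (delta p ^+ 2 * (A * F)) = delta p * B' * (F * (delta p * A)).
      by ring.
    by rewrite !ler_pM2l// mulr_gt0.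
  apply: (@le_trans _ _ (B * (F * A'))).
    by rewrite ler_wpM2r// mulr_ge0 ?(ltW Qz)// (le_trans _ h2)// mulr_ge0// ltW.
  have -> : B' * (r * (X * B)) = B * (r * (B' * X)) by ring.
  by rewrite ler_pM2l.
rewrite !EL; apply: (mean_contraction _ _ nu) => //; [exact: minor | exact: minor |].
rewrite (_ : Ppn _ _ f = fun u => Q G (m + p) n f u * (g u)^-1)//.
apply: bdmM; first exact: bdm_Qpn.
have [lo lo0 hlo] := Qpn_bounded_below M G _ _ bG G0 pmn.
exact: (bdmV lo).
Qed.

Lemma beta_geometric p n k (theta : R) : 0 <= theta < 1 ->
  (forall j, theta * rkl j.+1 (j.+1 + m.-1) <= delta j ^+ 2) ->
  (k * m + p <= n)%N -> beta p n <= (1 - theta) ^+ k.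
Proof.
move=> th hth kn; apply: beta_le => // f x y fO.
have bf := Osc1_bdm _ (inhS n) fO.
elim: k p kn x y => [|k ih] p kn x y.
  rewrite expr0; rewrite mul0n add0n in kn.
  apply: (mean_osc (fun h => Ppn p n h x) (fun h => Ppn p n h y)) => //.
  - exact: Ppn_mean.
  - exact: Ppn_mean.
  - by case: fO.
rewrite exprS; apply: Ppn_contraction => //.
  by rewrite (leq_trans _ kn)// mulSn -addnA addnCA leq_addl.
by move=> x' y'; apply: ih; rewrite (leq_trans _ kn)// mulSn addnCA addnA.
Qed.

End Mixing.

(** * Summation over the time parameter *)

Lemma sum_expr_divn {R : realType} (m n : nat) (theta : R) :
  (0 < m)%N -> 0 < theta < 1 ->
  \sum_(0 <= j < n) (1 - theta) ^+ (j %/ m) <= m%:R / theta.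
Proof.
move=> m0 /andP[t0 t1]; have x0 : 0 <= 1 - theta by rewrite subr_ge0 ltW.
(* Over whole blocks of length [m] the sum is exactly geometric; a general [n] is then extended to
   [n * m] by nonnegative terms. *)
have H k : theta * \sum_(0 <= j < k * m) (1 - theta) ^+ (j %/ m) =
    m%:R * (1 - (1 - theta) ^+ k).
  elim: k => [|k ih]; first by rewrite mul0n big_geq// expr0 subrr !mulr0.
  rewrite (@big_cat_nat _ _ _ (k * m))//=; last by rewrite mulSn leq_addl.
  rewrite mulrDr ih (@eq_big_nat _ _ _ (k * m) _ _ (fun=> (1 - theta) ^+ k)).
    by rewrite sumr_const_nat mulSn addnK -mulr_natl exprS; ring.
  move=> j /andP[kj jk]; congr (_ ^+ _); apply/eqP.
  by rewrite eqn_leq leq_divRL// kj andbT -ltnS ltn_divLR.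
rewrite ler_pdivlMr// mulrC.
apply: (@le_trans _ _ (theta * \sum_(0 <= j < n * m) (1 - theta) ^+ (j %/ m))).
  rewrite ler_wpM2l ?(ltW t0)// [leRHS](@big_cat_nat _ _ _ n)//=; last exact: leq_pmulr.
  by rewrite lerDl sumr_ge0// => j _; exact: exprn_ge0.
by rewrite H ler_piMr// gerBl exprn_ge0.
Qed.

Section MixingSum.
Context {R : realType} {d : nat -> measure_display}
  {S : forall n, measurableType (d n)}.
Variables (M : forall n, R.-pker S n ~> S n.+1) (G : forall n, S n -> R).
Hypotheses (bG : forall n, bdm (G n)) (G0 : forall n, bounded_below (G n))
  (inhS : forall n, inhabited (S n)).
Local Notation qpn := (@Defs.qpn R d S M G).
Local Notation beta := (@Defs.beta R d S M G).

Lemma sum_qpn_beta m (delta : nat -> R) (rb rl dl : R) n :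
  (0 < m)%N -> condM M m delta ->
  (forall p, rkl M G p (p + m) <= rb) -> (forall p, rkl M G p.+1 (p + m) <= rl) ->
  0 < dl -> (forall p, dl <= delta p) ->
  \sum_(0 <= p < n.+1) qpn p n ^+ 2 * beta p n <=
  2 * (m%:R * rl * rb ^+ 3 / dl ^+ 5).
Proof.
move=> m0 cM hrb hrl dl0 hdl.
have dl1 : dl < 1.
  by rewrite (le_lt_trans (hdl 0%N))//; case: cM => /(_ 0%N)/andP[].
have rb1 : 1 <= rb by apply: le_trans (hrb 0%N); apply: rkl_ge1 => //.
have rl1 : 1 <= rl by apply: le_trans (hrl 0%N); apply: rkl_ge1 => //.
have rb0 : 0 < rb by exact: lt_le_trans rb1.
have rl0 : 0 < rl by exact: lt_le_trans rl1.
pose theta := dl ^+ 2 / rl.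
have th0 : 0 < theta by rewrite divr_gt0// exprn_gt0.
have th1 : theta < 1.
  rewrite ltr_pdivrMr// mul1r (lt_le_trans _ rl1)// exprn_ilt1 ?ltW//.
have rkl0 p e : (p <= e)%N -> 0 <= rkl M G p e.
  by move=> pe; rewrite (le_trans ler01)// rkl_ge1.
have dp0 p : 0 < delta p by exact: lt_le_trans (hdl p).
have invd p : (delta p)^-1 <= dl^-1 by rewrite lef_pV2 ?posrE.
(* [A] bounds the square of [qpn p n] when [n - p >= m], and [B] when [n - p < m]. *)
pose A := (rb / dl) ^+ 2; pose B := rb ^+ 3 * rl / dl ^+ 2.
have A0 : 0 <= A by exact: sqr_ge0.
have B0 : 0 <= B by rewrite divr_ge0 ?mulr_ge0 ?exprn_ge0// ltW.
have q0 p : (p <= n)%N -> 0 <= qpn p n.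
  by move=> pn; rewrite (le_trans ler01)// qpn_ge1.
have term j : (j <= n)%N -> qpn (n - j) n ^+ 2 * beta (n - j) n <=
    A * (1 - theta) ^+ (j %/ m) + (if (j < m)%N then B else 0).
  move=> jn; set p := (n - j)%N; have pn : (p <= n)%N by exact: leq_subr.
  have b0 : 0 <= beta p n by exact: beta_ge0.
  have b1 : beta p n <= 1 by exact: beta_le1.
  have [jm|mj] := ltnP j m.
    rewrite divn_small// expr0 mulr1 ler_wpDl//.
    apply: (@le_trans _ _ (qpn p n ^+ 2)); first by rewrite ler_piMr// sqr_ge0.
    (* [qpn_short] needs [p < n]; at [p = n] the semigroup is the identity and the ratio is 1. *)
    have [j0|j0] := posnP j.
      have q1 : qpn p n <= 1.
        by rewrite /p j0 subn0; apply: qpn_le => // x y; rewrite !Qpn_id mulr1.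
      apply: (@le_trans _ _ 1); first by rewrite expr_le1// q0.
      rewrite /B ler_pdivlMr ?exprn_gt0// mul1r (@le_trans _ _ 1)//.
        by rewrite expr_le1// ltW.
      by rewrite -[1]mulr1 ler_pM// exprn_ege1.
    have pn' : (p < n)%N by rewrite ltn_subrL j0 (leq_trans j0).
    have nmp : (n < m + p)%N by rewrite addnBA// ltn_subRL ltn_add2r.
    have n0 : (0 < n)%N by exact: leq_ltn_trans pn'.
    have mpn : (m + p <= m + n.-1)%N by rewrite leq_add2l -ltnS prednK.
    have nmn : (n <= m + n.-1)%N.
      by rewrite -ltnS -addnS prednK// -[ltnLHS]add0n ltn_add2r.
    have pm : (p <= p + m)%N by rewrite leq_addr.
    (* A window starting at [n] of length [m.-1] costs [rl], one of length [m] costs [rb]; the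
       product of the two resulting bounds on [qpn] is exactly [B]. *)
    have s1 := qpn_short M G bG G0 inhS m delta cM p n (m + n.-1) pn' nmp.
    have s2 := qpn_short M G bG G0 inhS m delta cM p n (m + n) pn' nmp.
    have h1 : qpn p n <= rb * rl / dl.
      apply: le_trans (s1 mpn) _.
      apply: ler_pM => //; [|by rewrite invr_ge0 ltW|].
        by rewrite mulr_ge0 ?rkl0.
      apply: ler_pM => //; [exact: rkl0|exact: rkl0|].
      by have := hrl n.-1; rewrite prednK// addnC.
    have h2 : qpn p n <= rb * rb / dl.
      apply: le_trans (s2 _) _; first by rewrite leq_add2l.
      apply: ler_pM => //; [|by rewrite invr_ge0 ltW|].
        by rewrite mulr_ge0 ?rkl0// leq_addl.
      apply: ler_pM => //; [exact: rkl0|by rewrite rkl0// leq_addl|].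
      by rewrite addnC.
    have -> : B = rb * rl / dl * (rb * rb / dl).
      by rewrite /B; field; rewrite gt_eqF.
    by rewrite expr2 ler_pM// q0.
  rewrite addr0; apply: ler_pM => //; first exact: sqr_ge0.
    have h : qpn p n <= rb / dl.
      apply: (le_trans (qpn_long M G bG G0 inhS m delta cM p n _)).
        by rewrite addnBA// leq_subLR leq_add2r.
      by apply: ler_pM => //; [rewrite rkl0// leq_addr|rewrite invr_ge0 ltW].
    by rewrite /A lerXn2r// nnegrE ?q0// divr_ge0// ltW.
  apply: (beta_geometric M G bG G0 inhS m delta m0 cM).
  - by rewrite (ltW th0).
  - move=> i; have -> : (i.+1 + m.-1 = i + m)%N by rewrite addSnnS prednK.
    apply: (@le_trans _ _ (theta * rl)); first by rewrite ler_pM2l.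
    by rewrite /theta divfK ?gt_eqF// lerXn2r ?nnegrE// ltW.
  - by rewrite /p addnBA// leq_subLR leq_add2r leq_divM.
rewrite big_nat_rev/=; under eq_bigr do rewrite add0n subSS.
apply: (@le_trans _ _ (\sum_(0 <= j < n.+1) (A * (1 - theta) ^+ (j %/ m) +
    (if (j < m)%N then B else 0)))).
  by apply: ler_sum_nat => j; rewrite ltnS => /term.
rewrite big_split/= -mulr_sumr.
have sB k : \sum_(0 <= j < k) (if (j < m)%N then B else 0) = (minn k m)%:R * B.
  elim: k => [|k ih]; first by rewrite big_geq// min0n mul0r.
  rewrite big_nat_recr//= ih; case: ltnP => km.
    by rewrite !(minn_idPl _) ?(ltnW km)// -natr1; ring.
  by rewrite !(minn_idPr _) ?(leqW km)// addr0.
(* Each contribution lies below the same quantity, the geometric one with a spare factor [dl / rb]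
   and the short one with a spare [dl ^+ 3]; hence the 2 in the conclusion. *)
have h1 : A * (\sum_(0 <= j < n.+1) (1 - theta) ^+ (j %/ m)) <=
    m%:R * rl * rb ^+ 3 / dl ^+ 5.
  have sg := @sum_expr_divn R m n.+1 theta m0 (introT andP (conj th0 th1)).
  apply: (le_trans (ler_wpM2l A0 sg)).
  have -> : A * (m%:R / theta) = m%:R * rl * rb ^+ 3 / dl ^+ 5 * (dl / rb).
    by rewrite /A /theta; field; rewrite !gt_eqF.
  rewrite ler_piMr//.
    by rewrite divr_ge0 ?mulr_ge0 ?exprn_ge0 ?ler0n ?(ltW rb0) ?(ltW rl0) ?(ltW dl0).
  by rewrite ler_pdivrMr// mul1r ltW// (lt_le_trans dl1).
have h2 : (minn n.+1 m)%:R * B <= m%:R * rl * rb ^+ 3 / dl ^+ 5.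
  apply: (@le_trans _ _ (m%:R * B)).
    by rewrite ler_wpM2r// ler_nat geq_minr.
  have -> : m%:R * B = m%:R * rl * rb ^+ 3 / dl ^+ 5 * dl ^+ 3.
    by rewrite /B; field; rewrite gt_eqF.
  rewrite ler_piMr//.
    by rewrite divr_ge0 ?mulr_ge0 ?exprn_ge0 ?ler0n ?(ltW rb0) ?(ltW rl0) ?(ltW dl0).
  by rewrite exprn_ile1 ?ltW.
by rewrite sB mulrDl mul1r lerD.
Qed.

End MixingSum.

(** * Derivation of the two tail bounds *)

Lemma expR_ln_div {R : realType} (rho : R) : 0 < rho -> 6 * expR (- ln (6 / rho)) = rho.
Proof.
move=> r0; rewrite expRN lnK ?posrE ?divr_gt0//.
by field; rewrite gt_eqF.
Qed.

Theorem theorem4p5 (R : realType) (d : nat -> measure_display)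
  (S : forall n, measurableType (d n)) (eta0 : probability (S 0) R)
  (M : forall n, R.-pker S n ~> S n.+1) (G : forall n, S n -> R) :
  (forall n, measurable_fun setT (G n)) ->
  (forall n (x : S n), 0 < G n x < 1) ->
  (forall n, exists q : R, forall x y : S n, G n x <= q * G n y) ->
  (* (i) *)
  (forall (N : nat) dO (Omega : measurableType dO) (P : probability Omega R)
     (X : forall n, 'I_N -> Omega -> S n),
     (0 < N)%N -> particle_system eta0 M G P X ->
     forall (n : nat) (f : S n -> R) (eps : R),
       Osc1 f -> 0 <= eps <= 1 / 2 ->
       (P [set w | (eps <= `|empir (fun i => X n i w) f - etaFK eta0 M G f|)%R]
        <= (6 * expR (- (N%:R * eps ^+ 2) / (8 * sigma1 M G n)))%:E)%E)
  /\
  (* (ii) *)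
  (forall (m : nat) (delta : nat -> R),
     (0 < m)%N -> condM M m delta ->
     0 < inf (range delta) ->
     has_ubound (range (fun p => rkl M G p (p + m))) ->
     has_ubound (range (fun p => rkl M G p.+1 (p + m))) ->
     let dlt := inf (range delta) in
     let rbar := sup (range (fun p => rkl M G p (p + m))) in
     let rlow := sup (range (fun p => rkl M G p.+1 (p + m))) in
     forall (N : nat) dO (Omega : measurableType dO) (P : probability Omega R)
       (X : forall n, 'I_N -> Omega -> S n),
       (0 < N)%N -> particle_system eta0 M G P X ->
       forall (n : nat) (f : S n -> R) (rho : R),
         Osc1 f -> 0 < rho < 1 ->
         ((1 - rho)%:E <=
         P [set w | (`|empir (fun i => X n i w) f - etaFK eta0 M G f|
                    <= 4 * rbar / dlt ^+ 2 *
                       Num.sqrt (2 * m%:R * rlow * rbar / (N%:R * dlt)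
                                 * ln (6 / rho)))%R])%E).
Proof.
move=> mG G01 Gq.
(* Each space carries a probability, so no supremum below runs over an empty set of points. *)
have inhS n : inhabited (S n).
  elim: n => [|n [x]]; first exact: (probability_inhabited _ (probability_setT eta0)).
  exact: (probability_inhabited (M n x) (prob_kernel x)).
have Gpos n x : 0 < G n x by have /andP[] := G01 n x.
have bG n : bdm (G n).
  split => //; exists 1 => x; rewrite gtr0_norm// ltW//.
  by have /andP[] := G01 n x.
have G0 n : bounded_below (G n).
  have [q hq] := Gq n; have [x] := inhS n.
  have q0 : 0 < q.
    by have := hq x x; rewrite -ler_pdivrMr// divff ?gt_eqF// => /(lt_le_trans ltr01).
  exists (G n x / q); first by rewrite divr_gt0.
  by move=> y; rewrite ler_pdivrMr// mulrC.
have bf n f : Osc1 f -> bdm (f : S n -> R) by exact: Osc1_bdm.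
have bD N dO (Omega : measurableType dO) (P : probability Omega R)
    (X : forall n, 'I_N -> Omega -> S n) n f :
    particle_system eta0 M G P X -> Osc1 f ->
    bdm (fun w => empir (fun i => X n i w) f - etaFK eta0 M G f).
  move=> PX fO; apply: bdmB; last exact: bdm_cst.
  by apply: bdm_empir; [case: PX | exact: bf].
split.
  move=> N dO Omega P X N0 PX n f eps fO /andP[eps0 eps1].
  rewrite /sigma1; set s := \sum_(_ <= p < _) _.
  have term p : (p <= n)%N ->
      Defs.qpn R d S M G p n ^+ 2 * Defs.beta R d S M G p n <=
      Defs.qpn R d S M G p n ^+ 3 * Defs.beta R d S M G p n.
    move=> pn; rewrite ler_wpM2r ?beta_ge0// exprS ler_peMl ?sqr_ge0//.
    exact: qpn_ge1.
  have term0 p : (p <= n)%N ->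
      0 <= Defs.qpn R d S M G p n ^+ 2 * Defs.beta R d S M G p n.
    by move=> pn; rewrite mulr_ge0 ?sqr_ge0 ?beta_ge0.
  have s0 : 0 <= s.
    rewrite /s big_nat sumr_ge0// => p /andP[_ pn].
    exact: le_trans (term0 p pn) (term p pn).
  (* If the sum is 0, the inverse of 0 is 0, the exponent vanishes and the bound reads 6. *)
  move: s0; rewrite le_eqVlt => /predU1P[<-|s0].
    rewrite mulr0 mulr0 invr0 mulr0 expR0 mulr1.
    apply: (@le_trans _ _ 1%E); first apply: probability_le1.
      by apply: measurable_norm_ge; exact: (bD N dO Omega P X n f PX fO).1.
    by rewrite lee_fin; lra.
  (* With [T = s] the tail has [16 * s] in its exponent, which is sharper than the [32 * s] coming
     from [sigma1]. *)
  apply: le_trans (concentration M G bG G0 inhS eta0 N dO Omega P X n f s eps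
    G01 N0 PX fO _ s0 _) _.
  - by rewrite eps0; lra.
  - by apply: ler_sum_nat => p; rewrite ltnS => /term.
  rewrite lee_fin ler_pM2l// ler_expR !mulNr lerN2.
  have Ne : 0 <= N%:R * eps ^+ 2 by rewrite mulr_ge0 ?sqr_ge0.
  by rewrite ler_wpM2l// lef_pV2 ?posrE ?mulr_gt0//; lra.
move=> m delta m0 cM dl0 ub1 ub2 dlt rbar rlow N dO Omega P X N0 PX n f rho fO.
move=> /andP[rho0 rho1].
have hrb p : rkl M G p (p + m) <= rbar by apply: ub_le_sup => //; exists p.
have hrl p : rkl M G p.+1 (p + m) <= rlow by apply: ub_le_sup => //; exists p.
have hdl p : dlt <= delta p.
  apply: ge_inf; last by exists p.
  by exists 0 => _ [j _ <-]; case: cM => /(_ j)/andP[/ltW].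
have rb0 : 0 < rbar.
  rewrite (lt_le_trans ltr01)// (le_trans _ (hrb 0%N))//.
  by apply: rkl_ge1 => //; rewrite leq_addr.
have rl0 : 0 < rlow.
  rewrite (lt_le_trans ltr01)// (le_trans _ (hrl 0%N))//.
  by apply: rkl_ge1.
pose T0 := m%:R * rlow * rbar ^+ 3 / dlt ^+ 5.
have T0_gt0 : 0 < T0.
  by rewrite divr_gt0 ?exprn_gt0// !mulr_gt0 ?exprn_gt0// ltr0n.
have NR0 : 0 < N%:R :> R by rewrite ltr0n.
have mR0 : 0 < m%:R :> R by rewrite ltr0n.
set L := ln (6 / rho).
have L0 : 0 < L.
  by apply: ln_gt0; rewrite ltr_pdivlMr// mul1r; lra.
set eps := 4 * rbar / dlt ^+ 2 * _.
(* The deviation is calibrated so that, with [T = 2 * T0], the tail of [concentration] equals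
   [6 * expR (- L)], that is [rho]. *)
have eps2 : N%:R * eps ^+ 2 = L * (16 * (2 * T0)).
  rewrite /eps exprMn sqr_sqrtr; last first.
    by rewrite mulr_ge0 ?(ltW L0)// divr_ge0 ?mulr_ge0// ?ltW// mulr_gt0.
  by rewrite /T0; field; rewrite !gt_eqF.
have eps0 : 0 <= eps.
  by rewrite /eps mulr_ge0 ?sqrtr_ge0// divr_ge0 ?sqr_ge0// mulr_ge0// ltW.
pose D w := empir (fun i => X n i w) f - etaFK eta0 M G f.
have mA : measurable [set w | eps <= `|D w|].
  by apply: measurable_norm_ge; exact: (bD N dO Omega P X n f PX fO).1.
have mB : measurable [set w | `|D w| <= eps].
  have mN : measurable_fun setT (fun w => `|D w|).
    by apply: measurableT_comp => //; exact: (bD N dO Omega P X n f PX fO).1.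
  rewrite (_ : [set w | _] = (fun w => `|D w|) @^-1` `]-oo, eps]).
    by rewrite -[X in measurable X]setTI; exact: mN.
  by apply/seteqP; split => w /=; rewrite in_itv.
(* [concentration] requires [eps <= 1]; beyond 1 the event is everything, since [f] oscillates by at
   most 1. *)
have [eps1|eps1] := leP eps 1; last first.
  have D1 w : `|D w| <= 1.
    apply: (mean_osc (fun h => empir (fun i => X n i w) h)
      (fun h => etaFK eta0 M G h)) => //; [|exact: etaFK_mean|exact: bf|by case: fO].
      split; rewrite /empir.
      - by rewrite sumr_const card_ord mulVf ?gt_eqF.
      - move=> c h k _ _; rewrite big_split/= -mulr_sumr; ring.
      - by move=> h _ h0; rewrite mulr_ge0 ?invr_ge0 ?ler0n// sumr_ge0.
  rewrite (_ : [set w | _] = setT); last first.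
    apply/seteqP; split => // w _ /=; exact: le_trans (D1 w) (ltW eps1).
  by rewrite probability_setT lee_fin gerBl ltW.
have conc := concentration M G bG G0 inhS eta0 N dO Omega P X n f (2 * T0) eps
  G01 N0 PX fO (introT andP (conj eps0 eps1)) (mulr_gt0 (ltr0Sn R 1) T0_gt0)
  (sum_qpn_beta M G bG G0 inhS m delta rbar rlow dlt n m0 cM hrb hrl dl0 hdl).
have T16 : 0 < 16 * (2 * T0) by apply: mulr_gt0 => //; exact: mulr_gt0.
rewrite eps2 mulNr mulfK ?gt_eqF// in conc.
rewrite /L expR_ln_div// in conc.
apply: (@le_trans _ _ (P (~` [set w | eps <= `|D w|]))).
  rewrite probability_setC// EFinB leeB//.
apply: le_measure; rewrite ?inE//; first exact: measurableC.
by move=> w /= /negP; rewrite -ltNge => /ltW.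
Qed.
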